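(* Let $d\ge1$ and $\Gamma:=\{(Q,k): Q\in\mathcal{D}_d,\ 1\leq k<2^d\}$. There are positive constants $\tilde c(d)$ and $C(d)$, depending only on $d$, such that the following holds. Let $0\leq\eta\leq\tilde c(d)$ and let $\{h_{(Q),k}\}_{(Q,k)\in\Gamma}$ be the Haar functions. Suppose that, for every $(Q,k)\in\Gamma$, there is a real $d\times d$ matrix $A^{(Q),k}$ and a vector $y^{(Q),k}\in\mathbf{R}^d$ such that $$\Vert A^{(Q),k}-I_d\Vert_\infty+\Vert y^{(Q),k}\Vert_\infty\leq\eta.$$ For every $(Q,k)\in\Gamma$ define $$\widetilde{h_{(Q),k}}(x):=h_{(Q),k}\bigl(x_Q+A^{(Q),k}(\ell(Q)y^{(Q),k}+x-x_Q)\bigr).$$ Then $$\left\Vert\left\{h_{(Q),k}-\widetilde{h_{(Q),k}}\right\}_{(Q,k)\in\Gamma}\right\Vert_{AO(\Gamma)}\leq C(d)\,\eta^{1/2}.$$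
   Context: Bessel families: a family $\{\psi_\gamma\}_{\gamma\in\Gamma}\subset L^2(\mathbf{R}^d)$ is a Bessel family if there is $0\le B<\infty$ with $\sum_{\gamma\in\Gamma}|\langle f,\psi_\gamma\rangle|^2\leq B\Vert f\Vert_2^2$ for all $f\in L^2(\mathbf{R}^d)$, where $\langle f,g\rangle=\int f\overline{g}\,dx$; the minimal such $B$ is the optimal bound. $AO(\Gamma)$ is the vector space of Bessel families indexed by $\Gamma$, and $\Vert\{\psi_\gamma\}_{\gamma\in\Gamma}\Vert_{AO(\Gamma)}$ is the square root of the optimal bound. A bound on the $AO(\Gamma)$ norm includes the assertion that the family is Bessel. Dyadic cubes: a dyadic interval is an interval $[j2^n,(j+1)2^n)$ with $j,n$ integers. A cube $Q\subset\mathbf{R}^d$ is a product of $d$ half-open intervals $[a,b)$ of the same length $\ell(Q)$; $x_Q$ is its center. $Q$ is dyadic if all its factors are dyadic; $\mathcal{D}_d$ is the set of dyadic cubes in $\mathbf{R}^d$. Haar functions: for a dyadic interval $I$ with left and right halves $I_l,I_r$, $h^{(I)}:=\chi_{I_l}-\chi_{I_r}$. For $Q_0=[0,1)^d$, let $h_{(Q_0),k}$, $1\le k<2^d$, be a fixed enumeration of the $2^d-1$ functions $\prod_{i=1}^dg_i(x_i)$ where each $g_i$ is either $h^{([0,1))}$ or $\chi_{[0,1)}$ and not all $g_i$ equal $\chi_{[0,1)}$. For $Q=\prod_{i=1}^d[j_i2^n,(j_i+1)2^n)$ put $h_{(Q),k}(x_1,\dots,x_d):=2^{-nd/2}h_{(Q_0),k}(2^{-n}x_1-j_1,\dots,2^{-n}x_d-j_d)$.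 Norms: for a real $d\times l$ matrix $B=[b_{ij}]$, $\Vert B\Vert_\infty:=\max_{1\le i\le d}\sum_{j=1}^l|b_{ij}|$; for a (column) vector, $\Vert x\Vert_\infty=\max_i|x_i|$. $I_d$ is the $d\times d$ identity. *)

(* Defs.v *)
From HB Require Import structures.
From mathcomp Require Import all_boot all_order all_algebra.
From mathcomp Require Import complex.
From mathcomp Require Import all_classical all_reals all_analysis.

Set Implicit Arguments.
Unset Strict Implicit.
Unset Printing Implicit Defensive.
Import Order.TTheory GRing.Theory Num.Theory.
Import numFieldNormedType.Exports.

Local Open Scope classical_set_scope.
Local Open Scope ring_scope.

(* The sigma-algebra of 'cV[T]_n is generated by the n coordinates; for T = R
   this is the Borel sigma-algebra of R^n. *)
Definition measure_cV_display : measure_display -> measure_display.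
Proof. exact. Qed.

Section measurable_cV.
Context {d} {T : measurableType d}.
Variable n : nat.

Let coord : 'I_n -> 'cV[T]_n -> T := fun i v => v i ord0.

Let cV_set0 : g_sigma_preimage coord set0.
Proof. exact: sigma_algebra0. Qed.

Let cV_setC A : g_sigma_preimage coord A -> g_sigma_preimage coord (~` A).
Proof. exact: sigma_algebraC. Qed.

Let cV_bigcup (F : _^nat) : (forall i, g_sigma_preimage coord (F i)) ->
  g_sigma_preimage coord (\bigcup_i (F i)).
Proof. exact: sigma_algebra_bigcup. Qed.

HB.instance Definition _ := @isMeasurable.Build (measure_cV_display d)
  'cV[T]_n (g_sigma_preimage coord) cV_set0 cV_setC cV_bigcup.

End measurable_cV.

Lemma measurable_coord d (T : measurableType d) n (i : 'I_n) :
  measurable_fun [set: 'cV[T]_n] (fun v : 'cV[T]_n => v i ord0).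
Proof.
move=> _ Y mY; rewrite setTI; apply: sub_sigma_algebra => /=.
rewrite -bigcup_seq/=; exists i => /=; first by rewrite mem_index_enum.
by exists Y => //; rewrite setTI.
Qed.

Lemma measurable_fun_coordP d1 d2 (T1 : measurableType d1)
    (T2 : measurableType d2) n (f : T1 -> 'cV[T2]_n) :
  measurable_fun [set: T1] f <->
  forall i, measurable_fun [set: T1] (fun x => f x i ord0).
Proof.
split=> [mf i|mf].
  exact: measurableT_comp (measurable_coord i) mf.
have pre : g_sigma_preimage (fun (i : 'I_n) x => f x i ord0) `<=` measurable.
  apply: smallest_sub; first exact: sigma_algebra_measurable.
  case: n => [|n] in f mf *; first by rewrite big_ord0.
  rewrite -bigcup_mkord_ord; apply: bigcup_sub => i Ii.
  by move=> A [B mB <-]; exact: mf.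
move=> _ A mA; apply: pre.
rewrite (@g_sigma_preimage_comp _ _ n _
  (fun (i : 'I_n) (v : 'cV[T2]_n) => v i ord0) _ f).
by exists A.
Qed.

Section lebesgue_cV.
Context {R : realType}.

Definition cV_cons n (xv : measurableTypeR R * 'cV[R]_n) : 'cV[R]_n.+1 :=
  col_mx (xv.1%:M : 'M[R]_1) xv.2.

Lemma cV_consE0 n xv : @cV_cons n xv ord0 ord0 = xv.1.
Proof.
transitivity (cV_cons xv (@lshift 1 n ord0) ord0).
  by congr (cV_cons xv _ _); exact/val_inj.
by apply: (etrans (col_mxEu _ _ _ _)); rewrite mxE.
Qed.

Lemma cV_consES n xv j : @cV_cons n xv (lift ord0 j) ord0 = xv.2 j ord0.
Proof.
transitivity (cV_cons xv (@rshift 1 n j) ord0).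
  by congr (cV_cons xv _ _); exact/val_inj.
exact: col_mxEd.
Qed.

Lemma measurable_cV_cons n : measurable_fun setT (@cV_cons n).
Proof.
apply/measurable_fun_coordP => i; case: (unliftP ord0 i) => [j|] ->.
- under eq_fun do rewrite cV_consES.
  exact: measurableT_comp (measurable_coord j) measurable_snd.
- under eq_fun do rewrite cV_consE0.
  exact: measurable_fst.
Qed.

Section step.
Variables (n : nat) (mu : {sigma_finite_measure set 'cV[R]_n -> \bar R}).

Definition lebesgue_cV_step : set 'cV[R]_n.+1 -> \bar R :=
  pushforward (lebesgue_measure \x mu)%E (@cV_cons n).

Let step0 : lebesgue_cV_step set0 = 0%E.
Proof.
rewrite /lebesgue_cV_step /pushforward preimage_set0.
exact: (measure0 [the measure _ _ of (lebesgue_measure \x mu)%E]).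
Qed.

Let step_ge0 A : (0 <= lebesgue_cV_step A)%E.
Proof.
rewrite /lebesgue_cV_step /pushforward.
exact: (measure_ge0 [the measure _ _ of (lebesgue_measure \x mu)%E]).
Qed.

Let step_sigma_additive : semi_sigma_additive lebesgue_cV_step.
Proof.
move=> F mF tF mUF.
pose nu := measure_function_pushforward__canonical__measure_function_Measure
  (lebesgue_measure \x mu)%E (@measurable_cV_cons n).
exact: (@measure_semi_sigma_additive _ _ _ nu).
Qed.

HB.instance Definition _ := isMeasure.Build _ _ _
  lebesgue_cV_step step0 step_ge0 step_sigma_additive.

Let step_sigma_finite : sigma_finite setT lebesgue_cV_step.
Proof.
have /sigma_finiteP[F [TF ndF Foo]] := sigma_finiteT (@lebesgue_measure R).
have /sigma_finiteP[G [TG ndG Goo]] := sigma_finiteT mu.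
pose uncons (v : 'cV[R]_n.+1) : measurableTypeR R * 'cV[R]_n :=
  (v ord0 ord0, \col_j v (lift ord0 j) ord0).
have unconsK : cancel (@cV_cons n) uncons.
  move=> [x v]; rewrite /uncons cV_consE0; congr pair.
  by apply/colP => j; rewrite mxE cV_consES.
have muncons : measurable_fun setT uncons.
  apply/measurable_fun_pair; first exact: measurable_coord.
  apply/measurable_fun_coordP => j; under eq_fun do rewrite mxE.
  exact: measurable_coord.
exists (fun k => uncons @^-1` (F k `*` G k)).
  apply/seteqP; split=> // v _; have /= [x y] := uncons v.
  have [k _ Fk] : (\bigcup_k F k) (uncons v).1 by rewrite -TF.
  have [l _ Gl] : (\bigcup_k G k) (uncons v).2 by rewrite -TG.
  exists (maxn k l) => //; split.
    by move: Fk; exact/subsetPset/ndF/leq_maxl.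
  by move: Gl; exact/subsetPset/ndG/leq_maxr.
move=> k; have [mF Fk] := Foo k; have [mG Gk] := Goo k; split.
  by rewrite -[X in measurable X]setTI; apply: muncons => //; exact: measurableX.
rewrite /lebesgue_cV_step /pushforward -comp_preimage.
rewrite (_ : uncons \o _ = id); last by apply/funext => x /=.
by rewrite preimage_id product_measure1E// lte_mul_pinfty// ge0_fin_numE.
Qed.

HB.instance Definition _ := Measure_isSigmaFinite.Build _ _ _
  lebesgue_cV_step step_sigma_finite.

End step.

(* Lebesgue measure on R^n, as an iterated product (see lebesgue_cV_box). *)
Fixpoint lebesgue_cV n : {sigma_finite_measure set 'cV[R]_n -> \bar R} :=
  if n is n'.+1 then lebesgue_cV_step (lebesgue_cV n') else \d_(0 : 'cV[R]_0).

Lemma lebesgue_cV_box n (A : 'I_n -> set R) : (forall i, measurable (A i)) ->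
  lebesgue_cV n [set v : 'cV[R]_n | forall i, A i (v i ord0)] =
  (\prod_(i < n) lebesgue_measure (A i))%E.
Proof.
elim: n A => [|n IHn] A mA.
  by rewrite big_ord0 /= diracE mem_set//= => -[].
rewrite big_ord_recl -IHn// -product_measure1E//.
- congr (product_measure1 _ _ _); apply/seteqP; split=> [xv /= Axv|xv /= [Ax Av] i].
    split=> [|j /=]; first by rewrite -(cV_consE0 xv).
    by rewrite -cV_consES.
  by case: (unliftP ord0 i) => [j|] ->; rewrite ?cV_consE0 ?cV_consES.
- exact: mA.
- rewrite (_ : mkset _ =
    \bigcap_(i in [set: 'I_n]) ((fun v : 'cV[R]_n => v i ord0) @^-1` A (lift ord0 i))).
    apply: fin_bigcap_measurable => // i _; rewrite -[X in measurable X]setTI.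
    exact: measurable_coord.
  by apply/seteqP; split=> [v Av i _|v Av i]; [exact: Av|exact: (Av i)].
Qed.

End lebesgue_cV.

Section bessel.
Context {R : realType} {d : nat}.
Local Notation leb := (@lebesgue_cV R d).
Local Notation normc := (@ComplexField.Normc.normc R).
Implicit Types f g : 'cV[R]_d -> R[i].

Definition cintegral f : R[i] :=
  Complex (\int[leb]_x complex.Re (f x)) (\int[leb]_x complex.Im (f x)).

Definition L2norm f : \bar R :=
  Lnorm leb 2%:E (EFin \o normc \o f).

(* Elements of L^2 are represented by functions; every class has a Borel
   representative, and all notions below only depend on the class. *)
Definition L2 : set ('cV[R]_d -> R[i]) :=
  [set f | [/\ measurable_fun setT (fun x => complex.Re (f x)),
               measurable_fun setT (fun x => complex.Im (f x)) &
               (L2norm f < +oo)%E]].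

Definition L2inner f g : R[i] := cintegral (fun x => f x * conjc (g x)).

Definition bessel_bound (Gamma : choiceType) (psi : Gamma -> 'cV[R]_d -> R[i])
    (B : R) : Prop :=
  0 <= B /\ forall f, L2 f ->
    (\esum_(gamma in [set: Gamma])
        (normc (L2inner f (psi gamma)) ^+ 2)%:E
      <= B%:E * L2norm f ^+ 2)%E.

Definition AO (Gamma : choiceType) : set (Gamma -> 'cV[R]_d -> R[i]) :=
  [set psi | (forall gamma, L2 (psi gamma)) /\ exists B, bessel_bound psi B].

Definition AOnorm (Gamma : choiceType) (psi : Gamma -> 'cV[R]_d -> R[i]) : R :=
  Num.sqrt (inf [set B | bessel_bound psi B]).

End bessel.

Section haar.
Context {R : realType} {d : nat}.

(* (n, j) encodes the cube \prod_i [j_i 2^n, (j_i + 1) 2^n); the encoding is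
   injective for 0 < d (cube_set_inj). *)
Definition dyadic_cube : Type := (int * {ffun 'I_d -> int})%type.

HB.instance Definition _ := Choice.on dyadic_cube.

Implicit Types Q : dyadic_cube.

Definition side Q : R := 2 ^ Q.1.

Definition cube_set Q : set 'cV[R]_d :=
  [set x | forall i, x i ord0 \in `[(Q.2 i)%:~R * side Q,
                                    (Q.2 i + 1)%:~R * side Q[ ].

Definition cube_center Q : 'cV[R]_d :=
  \col_i (((Q.2 i)%:~R * side Q + (Q.2 i + 1)%:~R * side Q) / 2).

Definition chi01 : R -> R := \1_`[0, 1[%classic.

Definition h01 : R -> R := \1_`[0, 2^-1[%classic \- \1_`[2^-1, 1[%classic.

(* The functions \prod_i g_i with g_i = h01 for i in S and g_i = chi01
   otherwise, for S nonempty. *)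
Definition unit_haar_functions : set ('cV[R]_d -> R) :=
  [set (fun x : 'cV[R]_d =>
          \prod_i (if i \in S then h01 (x i ord0) else chi01 (x i ord0)))
  | S in [set S : {set 'I_d} | S != finset.set0]].

Definition haar_label : Type := {k : 'I_(2 ^ d) | (0 < k)%N}.

HB.instance Definition _ := Choice.on haar_label.

Definition haar_enumeration (h0 : haar_label -> 'cV[R]_d -> R) : Prop :=
  set_bij setT unit_haar_functions h0.

Definition haar_index : Type := (dyadic_cube * haar_label)%type.

HB.instance Definition _ := Choice.on haar_index.

Definition haar (h0 : haar_label -> 'cV[R]_d -> R) (g : haar_index)
    (x : 'cV[R]_d) : R :=
  2 `^ (- (g.1.1%:~R * d%:R) / 2) *
  h0 g.2 (\col_i (2 ^ (- g.1.1) * x i ord0 - (g.1.2 i)%:~R)).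

Definition perturbed_haar (h0 : haar_label -> 'cV[R]_d -> R)
    (A : haar_index -> 'M[R]_d) (y : haar_index -> 'cV[R]_d)
    (g : haar_index) (x : 'cV[R]_d) : R :=
  haar h0 g (cube_center g.1 + A g *m (side g.1 *: y g + x - cube_center g.1)).

Lemma cube_set_inj : (0 < d)%N -> injective cube_set.
Proof.
move=> d_gt0 Q Q' eQ.
have side_gt0 P : 0 < side P by rewrite exprz_gt0.
have mem_corner P : cube_set P (\col_i ((P.2 i)%:~R * side P)).
  move=> i; rewrite mxE in_itv/= lexx/= ltr_pM2r//.
  by rewrite ltr_int ltzD1.
have le_corner P P' : cube_set P = cube_set P' ->
    forall i, (P'.2 i)%:~R * side P' <= (P.2 i)%:~R * side P.
  move=> eP i; have := mem_corner P; rewrite eP => /(_ i).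
  by rewrite mxE in_itv => /andP[].
have corner i : (Q.2 i)%:~R * side Q = (Q'.2 i)%:~R * side Q'.
  by apply/eqP; rewrite eq_le !le_corner.
have le_side P P' : cube_set P = cube_set P' ->
    (forall i, (P.2 i)%:~R * side P = (P'.2 i)%:~R * side P') ->
    side P' <= side P.
  move=> eP cP; rewrite leNgt; apply/negP => ltP.
  have : cube_set P (\col_i ((P.2 i + 1)%:~R * side P)).
    rewrite eP => i; rewrite mxE in_itv/= !rmorphD/= !mulrDl !mul1r cP.
    by rewrite lerDl ltW//= ltrD2l.
  by move=> /(_ (Ordinal d_gt0)); rewrite mxE in_itv/= ltxx andbF.
have eside : side Q = side Q' by apply/eqP; rewrite eq_le !le_side.
case: Q Q' => [n j] [n' j'] in eQ corner eside *.
have en : n = n'.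
  by apply: (@ieexprIz R 2) => //; rewrite ?ltr0n// -[1]/1%:R eqr_nat.
congr pair => //; apply/ffunP => i.
apply: (@intr_inj R); apply: (mulIf (lt0r_neq0 (side_gt0 (n', j')))).
by rewrite -corner eside.
Qed.

End haar.
Arguments dyadic_cube : clear implicits.
Arguments haar_label : clear implicits.
Arguments haar_index : clear implicits.

Definition mxnorm_oo (R : realType) (m n : nat) (B : 'M[R]_(m, n)) : R :=
  \big[Num.max/0]_(i < m) \sum_(j < n) `|B i j|.

(* Main.v *)
(* Write [psi_g] for the difference of the Haar function of a cube [Q] and its
   perturbation. It is supported in a fixed dilate of [Q], is bounded by
   [2 |Q|^(-1/2)], has mean zero, and vanishes except within [3 eta l(Q)] of the
   grid hyperplanes of [Q], so its L^1 norm is [O(eta |Q|^(1/2))]. If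
   [l(P) <= l(Q)], then [<psi_Q, psi_P>] is [O(eta (|P| / |Q|)^(1/2))], and by
   mean zero it vanishes unless the support of [psi_P] meets a discontinuity of
   [psi_Q]; at most [O(2^(m (d - 1)))] cubes [P] with [l(P) = 2^(-m) l(Q)] do.
   Schur's test with weights [l(Q)^((d - 1) / 2)] then bounds the Gram matrix by
   [C eta \sum_m 2^(-m/2)], and the Bessel bound is the norm of the Gram
   matrix. *)

Require Import Defs.
From mathcomp Require Import all_boot all_order all_algebra.
From mathcomp Require Import complex.
From mathcomp Require Import all_classical all_reals all_analysis.
From mathcomp Require Import measurable_realfun zify ring lra.
Import Order.TTheory GRing.Theory Num.Theory.
Import numFieldNormedType.Exports.
Local Open Scope classical_set_scope.
Local Open Scope ring_scope.

Set Implicit Arguments.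
Unset Strict Implicit.
Unset Printing Implicit Defensive.

(** * Translation invariance of Lebesgue measure *)

(** Gram entries are linear in [eta], and [AOnorm] is the square root of the Bessel bound; hence the
    exponent 1/2. The weights are dictated by lopsided rows: in dimension n, up to a constant,
    2^(m(n-1)) smaller cubes at level difference m interact with [Q], but only boundedly many larger
    ones, while every entry carries 2^(-mn/2). Weight ratios 2^(-m(n-1)/2) and 2^(m(n-1)/2) leave
    2^(-m/2) on either side. The obstacle is the count of smaller cubes: the discontinuities of a
    perturbed function lie on tilted hyperplanes, not aligned with the dyadic grid. Since [A] is
    close to the identity, a tilted hyperplane still crosses every line parallel to its axis
    transversally, so a column of cubes has boundedly many members close to it. Finite index lists
    suffice, because the sum over the family is a supremum of finite sums. *)

Section translation.
Context {R : realType}.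

Local Notation pushmeas :=
  measure_function_pushforward__canonical__measure_function_Measure.

Lemma measurable_addr (a : R) :
  measurable_fun setT (fun x : measurableTypeR R => (x + a : measurableTypeR R)).
Proof. by apply: measurable_funD => //; exact: measurable_cst. Qed.

(** Translation preserves the length of the intervals []b, c]], and these lengths characterize
    Lebesgue measure. *)
Lemma lebesgue_measure_translate (a : R) (A : set (measurableTypeR R)) :
  measurable A ->
  lebesgue_measure ((fun x => x + a) @^-1` A) = lebesgue_measure A.
Proof.
move=> mA; apply/esym.
pose nu := pushmeas lebesgue_measure (measurable_addr a).
apply: (@lebesgue_measure_unique R nu) => // X [[b c] _ <-].
rewrite /nu /= /pushforward.
have -> : (fun x : R => x + a) @^-1` `]b, c]%classic = `]b - a, c - a]%classic.
  by apply/seteqP; split=> x /=; rewrite !in_itv /= ltrBlDr lerBrDr.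
rewrite !lebesgue_measure_itv /= !lte_fin ltrD2r; case: ifP => // _.
by rewrite -!EFinD; congr EFin; ring.
Qed.

Lemma measurable_cV_addr n (v : 'cV[R]_n) :
  measurable_fun setT (fun x : 'cV[R]_n => x + v).
Proof.
apply/measurable_fun_coordP => i; under eq_fun do rewrite mxE.
by apply: measurable_funD => //; exact: measurable_coord.
Qed.

(** Through [cV_cons] the translation becomes the product [phi] of a translation of the line and one
    of the remaining coordinates. The pushforward of the product measure under [phi] has the right
    values on rectangles, and these determine it. *)
Lemma lebesgue_cV_translate n (v : 'cV[R]_n) (A : set 'cV[R]_n) :
  measurable A ->
  lebesgue_cV n ((fun x => x + v) @^-1` A) = lebesgue_cV n A.
Proof.
elim: n v A => [|n IHn] v A mA.
  congr (lebesgue_cV 0 _); apply/seteqP; split=> x /=;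
    by rewrite (_ : x + v = x)//; apply/colP => -[].
pose v' : 'cV[R]_n := \col_j v (lift ord0 j) ord0.
pose phi (xw : measurableTypeR R * 'cV[R]_n) : measurableTypeR R * 'cV[R]_n :=
  (xw.1 + v ord0 ord0, xw.2 + v').
have mphi : measurable_fun setT phi.
  apply/measurable_fun_pair.
    exact: measurableT_comp (measurable_addr _) measurable_fst.
  exact: measurableT_comp (measurable_cV_addr _) measurable_snd.
have mX : measurable (@cV_cons R n @^-1` A).
  by rewrite -[X in measurable X]setTI; exact: measurable_cV_cons.
pose nu := pushmeas (lebesgue_measure \x lebesgue_cV n)%E mphi.
transitivity (nu (@cV_cons R n @^-1` A)).
  congr ((lebesgue_measure \x lebesgue_cV n)%E _).
  apply/seteqP; split=> -[x w] /=; rewrite (_ : _ + v = cV_cons (phi (x, w)))//;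
  apply/colP => i; rewrite mxE; case: (unliftP ord0 i) => [j|] ->;
    by rewrite ?cV_consES ?cV_consE0 // !mxE.
apply/esym; apply: product_measure_unique => // B C mB mC.
rewrite /nu /= /pushforward -(IHn v') // -(lebesgue_measure_translate (v ord0 ord0) mB).
rewrite -product_measure1E//.
- by rewrite -[X in measurable X]setTI; exact: measurable_addr.
- by rewrite -[X in measurable X]setTI; exact: measurable_cV_addr.
Qed.

Lemma Rintegral_translate n (v : 'cV[R]_n) (f : 'cV[R]_n -> R) :
  measurable_fun setT f ->
  (lebesgue_cV n).-integrable setT (EFin \o f) ->
  (lebesgue_cV n).-integrable setT (EFin \o (fun x : 'cV[R]_n => f (x + v))) /\
  Rintegral (lebesgue_cV n) setT (fun x : 'cV[R]_n => f (x + v)) =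
  \int[lebesgue_cV n]_x f x.
Proof.
move=> mf fi.
have mfE : measurable_fun setT (EFin \o f) by exact/measurable_EFinP.
have mfv : measurable_fun setT (fun x : 'cV[R]_n => f (x + v)).
  exact: measurableT_comp mf (measurable_cV_addr v).
pose nu := pushmeas (lebesgue_cV n) (measurable_cV_addr v).
have E (g : 'cV[R]_n -> \bar R) :
    (\int[nu]_x g x = \int[lebesgue_cV n]_x g x)%E.
  by apply: eq_measure_integral => A mA _; exact: lebesgue_cV_translate.
have fvi : (lebesgue_cV n).-integrable setT (EFin \o (fun x : 'cV[R]_n => f (x + v))).
  apply/integrableP; split; first exact/measurable_EFinP.
  have /integrableP[_] := fi; rewrite -(E (fun x => `|(EFin \o f) x|%E)).
  rewrite ge0_integral_pushforward//; first exact: measurable_cV_addr.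
  by apply: measurableT_comp => //; exact/measurable_EFinP.
split => //; rewrite /Rintegral; congr fine.
rewrite -[RHS]E integral_pushforward//; exact: measurable_cV_addr.
Qed.

End translation.

(** * Bessel bounds from Gram matrices *)

(** Each term is at most the mean of [r i j] and [r j i]. Summed over both indices the two halves
    agree, so a bound on the weighted rows is enough. *)
Lemma schur_test (R : realFieldType) (I : eqType) (s : seq I)
    (G : I -> I -> R) (w a : I -> R) (B : R) :
  (forall i j, G i j = G j i) -> (forall i, 0 < w i) ->
  (forall i, i \in s -> \sum_(j <- s) `|G i j| * w j <= B * w i) ->
  \sum_(i <- s) \sum_(j <- s) a i * a j * G i j <= B * \sum_(i <- s) a i ^+ 2.
Proof.
move=> Gsym w0 HB.
pose r i j := `|G i j| * (w j / w i) * a i ^+ 2.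
have rB i : i \in s -> \sum_(j <- s) r i j <= B * a i ^+ 2.
  move=> si; rewrite /r -mulr_suml ler_wpM2r ?sqr_ge0//.
  under eq_bigr do rewrite mulrA; rewrite -mulr_suml ler_pdivrMr//; exact: HB.
(* AM-GM: [2 p q <= rho p^2 + q^2 / rho] with [rho = w j / w i] *)
have le_r i j : a i * a j * G i j <= (r i j + r j i) / 2.
  apply: (le_trans (ler_norm _)); rewrite /r (Gsym j i) !normrM.
  rewrite -(real_normK (num_real (a i))) -(real_normK (num_real (a j))).
  have wi := w0 i; have wj := w0 j.
  have rho0 : 0 < w j / w i by rewrite divr_gt0.
  have -> : w i / w j = (w j / w i)^-1 by rewrite invf_div.
  move: rho0; move: (w j / w i) `|a i| `|a j| => rho p q rho0.
  rewrite mulrC -!mulrA -mulrDr -mulrA ler_wpM2l// -subr_ge0.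
  rewrite (_ : _ - _ = (rho * p - q) ^+ 2 / (2 * rho)); last by field; rewrite gt_eqF.
  by rewrite divr_ge0 ?sqr_ge0// mulr_ge0 ?ltW.
apply: (@le_trans _ _ (\sum_(i <- s) \sum_(j <- s) (r i j + r j i) / 2)).
  by apply: ler_sum => i _; apply: ler_sum => j _.
have -> : \sum_(i <- s) \sum_(j <- s) (r i j + r j i) / 2 =
    \sum_(i <- s) \sum_(j <- s) r i j.
  under eq_bigr do rewrite -mulr_suml big_split /=.
  by rewrite -mulr_suml big_split /= [X in _ + X]exchange_big /=; field.
by rewrite mulr_sumr !big_seq; apply: ler_sum => i; exact: rB.
Qed.

Section square_integrable.
Context d (T : measurableType d) (R : realType).
Variable mu : {measure set T -> \bar R}.

Definition sqint (f : T -> R) :=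
  measurable_fun setT f /\ mu.-integrable setT (EFin \o (fun x => f x ^+ 2)).

Local Notation inner f g := (Rintegral mu setT (fun x => f x * g x)).

Lemma integrable_sqintM f g : sqint f -> sqint g ->
  mu.-integrable setT (EFin \o (fun x => f x * g x)).
Proof.
move=> [mf f2] [mg g2].
have fg2 : mu.-integrable setT (EFin \o (fun x => f x ^+ 2 + g x ^+ 2)).
  by have := integrableD measurableT f2 g2; apply: eq_integrable.
apply: le_integrable fg2 => //.
  by apply/measurable_EFinP; exact: measurable_funM.
move=> x _ /=; rewrite lee_fin normrM [leRHS]ger0_norm; last first.
  by rewrite addr_ge0 ?sqr_ge0.
rewrite -(real_normK (num_real (f x))) -(real_normK (num_real (g x))).
have := sqr_ge0 (`|f x| - `|g x|); have := sqr_ge0 (`|f x|); have := sqr_ge0 (`|g x|).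
rewrite sqrrB; lra.
Qed.

Lemma sqintZ a f : sqint f -> sqint (fun x => a * f x).
Proof.
move=> [mf f2]; split; first by apply: measurable_funM => //; exact: measurable_cst.
have := integrableZl measurableT (a ^+ 2) f2; apply: eq_integrable => // x _ /=.
by rewrite -EFinM exprMn.
Qed.

Lemma sqintD f g : sqint f -> sqint g -> sqint (fun x => f x + g x).
Proof.
move=> sf sg; have fg := integrable_sqintM sf sg; move: sf sg => [mf f2] [mg g2].
split; first exact: measurable_funD.
have := integrableD measurableT (integrableD measurableT f2 g2)
  (integrableZl measurableT 2 fg).
by apply: eq_integrable => // x _ /=; rewrite -EFinM -!EFinD; congr EFin; ring.
Qed.

Lemma sqint0 : sqint (fun=> 0).
Proof.
split; first exact: measurable_cst.
by have := integrable0 mu setT; apply: eq_integrable => // x _ /=; rewrite expr0n.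
Qed.

Lemma innerDr f g h : sqint f -> sqint g -> sqint h ->
  inner f (fun x => g x + h x) = inner f g + inner f h.
Proof.
move=> sf sg sh; rewrite -RintegralD//; try exact: integrable_sqintM.
by congr Rintegral; apply/funext => x; rewrite mulrDr.
Qed.

Lemma innerZr a f g : sqint f -> sqint g ->
  inner f (fun x => a * g x) = a * inner f g.
Proof.
move=> sf sg; rewrite -RintegralZl//; last exact: integrable_sqintM.
by congr Rintegral; apply/funext => x; rewrite mulrCA.
Qed.

Lemma innerC f g : inner f g = inner g f.
Proof. by congr Rintegral; apply/funext => x; rewrite mulrC. Qed.

Lemma sqint_lincomb (I : Type) (s : seq I) (a : I -> R) (psi : I -> T -> R) :
  (forall i, sqint (psi i)) -> sqint (fun x => \sum_(i <- s) a i * psi i x).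
Proof.
move=> spsi; elim: s => [|i s IHs].
  by under eq_fun do rewrite big_nil; exact: sqint0.
by under eq_fun do rewrite big_cons; apply: sqintD => //; exact: sqintZ.
Qed.

Lemma inner_lincomb (I : Type) (s : seq I) (a : I -> R) (psi : I -> T -> R) u :
  sqint u -> (forall i, sqint (psi i)) ->
  inner u (fun x => \sum_(i <- s) a i * psi i x) =
  \sum_(i <- s) a i * inner u (psi i).
Proof.
move=> su spsi; elim: s => [|i s IHs].
  under eq_Rintegral do rewrite big_nil mulr0.
  by rewrite big_nil /Rintegral integral0.
under [LHS]eq_Rintegral do rewrite big_cons.
by rewrite innerDr ?innerZr ?big_cons ?IHs//; [exact: sqintZ|exact: sqint_lincomb].
Qed.

(* Expand [0 <= |u - t v|^2] for [v = \sum_i <u, psi_i> psi_i] and optimize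
   in [t]. *)
Lemma bessel_of_gram (I : eqType) (s : seq I) (psi : I -> T -> R) (u : T -> R)
    (B : R) :
  sqint u -> (forall i, sqint (psi i)) -> 0 <= B ->
  (forall a : I -> R, \sum_(i <- s) \sum_(j <- s) a i * a j * inner (psi i) (psi j)
    <= B * \sum_(i <- s) a i ^+ 2) ->
  \sum_(i <- s) inner u (psi i) ^+ 2 <= B * inner u u.
Proof.
move=> su spsi B0 HB.
pose a i := inner u (psi i); pose v x := \sum_(i <- s) a i * psi i x.
have sv : sqint v by exact: sqint_lincomb.
set S := \sum_(i <- s) _; have S0 : 0 <= S by apply: sumr_ge0 => i _; exact: sqr_ge0.
have uv : inner u v = S.
  by rewrite inner_lincomb//; apply: eq_bigr => i _; rewrite expr2.
have vv : inner v v <= B * S.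
  apply: le_trans (HB a); rewrite inner_lincomb// le_eqVlt; apply/orP; left; apply/eqP.
  apply: eq_bigr => i _; rewrite innerC inner_lincomb// mulr_sumr.
  by apply: eq_bigr => j _; rewrite mulrA.
have quad t : 0 <= inner u u - 2 * t * S + t ^+ 2 * (B * S).
  have stv : sqint (fun x => - t * v x) by exact: sqintZ.
  have : 0 <= inner (fun x => u x + - t * v x) (fun x => u x + - t * v x).
    by apply: Rintegral_ge0 => x _; rewrite -expr2 sqr_ge0.
  rewrite innerDr//; last exact: sqintD.
  rewrite innerC innerDr// [X in _ + X]innerZr//; last exact: sqintD.
  rewrite [X in _ + - t * X]innerC innerDr// !innerZr// [inner v u]innerC uv.
  by have := ler_wpM2l (sqr_ge0 t) vv; nra.
(* The best choice is [t = B^-1]. For [B = 0] the bound [quad] is affine in [t], and the [t] chosen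
   here would make it equal to -1 if [S] were positive. *)
have [B_eq0|B_neq0] := eqVneq B 0.
  rewrite B_eq0 mul0r leNgt; apply/negP => Sgt0.
  have := quad ((inner u u + 1) / (2 * S)).
  rewrite B_eq0 mul0r mulr0 addr0.
  rewrite (_ : 2 * _ * S = inner u u + 1); last by field; rewrite gt_eqF.
  by rewrite leNgt => /negP; apply; lra.
have Bgt0 : 0 < B by rewrite lt_neqAle eq_sym B_neq0.
rewrite -ler_pdivrMl//; have := quad B^-1.
rewrite (_ : B^-1 ^+ 2 * (B * S) = B^-1 * S); last by field.
by lra.
Qed.

End square_integrable.

(** * Reduction of the complex Bessel bound to real Gram forms *)

Section bessel_of_real.
Context {R : realType} {d : nat}.
Local Notation leb := (@lebesgue_cV R d).
Local Notation inner f g := (Rintegral leb setT (fun x => f x * g x)).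
Implicit Type f : 'cV[R]_d -> R[i].

Local Notation re f := (fun x => complex.Re (f x)).
Local Notation im f := (fun x => complex.Im (f x)).

Lemma L2norm_sqr f :
  (L2norm f ^+ 2 =
   \int[leb]_x (complex.Re (f x) ^+ 2 + complex.Im (f x) ^+ 2)%:E)%E.
Proof.
rewrite /L2norm unlock poweR12_sqrt; last first.
  by apply: integral_ge0 => x _; exact: poweR_ge0.
rewrite sqr_sqrte; last by apply: integral_ge0 => x _; exact: poweR_ge0.
apply: eq_integral => x _ /=; case: (f x) => a b /=.
rewrite ger0_norm ?sqrtr_ge0// powR_mulrn ?sqrtr_ge0//.
by rewrite sqr_sqrtr// addr_ge0 ?sqr_ge0.
Qed.

Lemma L2norm_sqr_lty f : L2 f -> (L2norm f ^+ 2 < +oo)%E.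
Proof. by move=> [_ _ ?]; rewrite expe2 lte_mul_pinfty ?Lnorm_ge0// ge0_fin_numE ?Lnorm_ge0. Qed.

Lemma sqint_L2 f : L2 f -> sqint leb (re f) /\ sqint leb (im f).
Proof.
move=> Lf; have := L2norm_sqr_lty Lf; rewrite L2norm_sqr => foo.
move: Lf => [mre mim _].
have mre2 : measurable_fun setT (fun x => complex.Re (f x) ^+ 2) by exact: measurable_funX.
have mim2 : measurable_fun setT (fun x => complex.Im (f x) ^+ 2) by exact: measurable_funX.
have f2 : leb.-integrable setT
    (EFin \o (fun x => complex.Re (f x) ^+ 2 + complex.Im (f x) ^+ 2)).
  apply/integrableP; split; first by apply/measurable_EFinP; exact: measurable_funD.
  rewrite (eq_integral (fun x => (complex.Re (f x) ^+ 2 + complex.Im (f x) ^+ 2)%:E))//.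
  by move=> x _ /=; rewrite ger0_norm// addr_ge0 ?sqr_ge0.
split; split => //; apply: le_integrable f2 => //; try exact/measurable_EFinP.
  by move=> x _ /=; rewrite lee_fin !ger0_norm ?addr_ge0 ?sqr_ge0// lerDl sqr_ge0.
by move=> x _ /=; rewrite lee_fin !ger0_norm ?addr_ge0 ?sqr_ge0// lerDr sqr_ge0.
Qed.

Lemma L2norm_sqr_inner f : L2 f -> (L2norm f ^+ 2 =
  (inner (re f) (re f) +
   inner (im f) (im f))%:E)%E.
Proof.
move=> /sqint_L2[[mre re2] [mim im2]]; rewrite L2norm_sqr.
under eq_integral do rewrite EFinD.
rewrite integralD// EFinD /Rintegral !fineK//.
  by apply: integrable_fin_num => //; exact: im2.
by apply: integrable_fin_num => //; exact: re2.
Qed.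

Lemma L2_real (psi : 'cV[R]_d -> R) :
  sqint leb psi -> L2 (fun x => (psi x)%:C%C).
Proof.
move=> [mpsi psi2]; split; [exact: mpsi|exact: (@measurable_cst _ _ _ _ _ (0 : R))|].
pose f x := (psi x)%:C%C.
suff : (L2norm f ^+ 2 < +oo)%E.
  have : (0 <= L2norm f)%E by exact: Lnorm_ge0.
  by rewrite -/f expe2; case: (L2norm f) => [r| |] _; rewrite ?ltry ?mulyy.
rewrite L2norm_sqr; under eq_integral do rewrite /= expr0n addr0.
by apply: integrable_lty => //; exact: psi2.
Qed.

Lemma normc_L2inner_real f (psi : 'cV[R]_d -> R) :
  ComplexField.Normc.normc (L2inner f (fun x => (psi x)%:C%C)) ^+ 2 =
  inner (re f) psi ^+ 2 + inner (im f) psi ^+ 2.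
Proof.
rewrite /L2inner /cintegral /= sqr_sqrtr ?addr_ge0 ?sqr_ge0//.
congr (_ ^+ 2 + _ ^+ 2); apply: eq_Rintegral => x _ /=; case: (f x) => a b /=.
  by rewrite oppr0 mulr0 subr0.
by rewrite oppr0 mulr0 add0r.
Qed.

(** [esum] is a supremum over finite sets, so only finite Gram forms without repeated indices occur.
    As [psi] is real, the real and imaginary parts of [f] obey the real Bessel inequality
    separately, with the same [B], and adding the two loses no constant. *)
Lemma AO_of_gram (Gamma : choiceType) (psi : Gamma -> 'cV[R]_d -> R) (B : R) :
  (forall g, sqint leb (psi g)) -> 0 <= B ->
  (forall (s : seq Gamma) (a : Gamma -> R), uniq s ->
    \sum_(i <- s) \sum_(j <- s) a i * a j * inner (psi i) (psi j)
      <= B * \sum_(i <- s) a i ^+ 2) ->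
  AO (fun g x => (psi g x)%:C%C) /\
  AOnorm (fun g x => (psi g x)%:C%C) <= Num.sqrt B.
Proof.
move=> spsi B0 gramB.
have boundB : bessel_bound (fun g x => (psi g x)%:C%C) B.
  split=> // f Lf; have [sre sim] := sqint_L2 Lf.
  rewrite /esum; apply: ge_ereal_sup => _ [X [finX _] <-].
  rewrite fsbig_finite// L2norm_sqr_inner// sumEFin -EFinM lee_fin.
  under eq_bigr do rewrite normc_L2inner_real.
  have gB := fun a => gramB _ a (finmap.fset_uniq (fset_set X)).
  rewrite big_split mulrDr; apply: lerD; exact: bessel_of_gram.
split; first by split=> [g|]; [exact: L2_real|exists B].
rewrite /AOnorm; apply: ler_wsqrtr; apply: ge_inf => //.
by exists 0 => C [].
Qed.

End bessel_of_real.

(** * Affine perturbations and Haar functions *)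

Section cV_norm.
Context {R : realType}.

Lemma ler_coord_norm n (v : 'cV[R]_n) i : `|v i ord0| <= `|v|.
Proof.
rewrite (_ : `|v| = mx_norm v)// mx_normrE; exact: (le_bigmax _ (fun p => `|v p.1 p.2|) (i, ord0)).
Qed.

Lemma cV_norm_le n (v : 'cV[R]_n) r :
  0 <= r -> (forall i, `|v i ord0| <= r) -> `|v| <= r.
Proof.
by move=> r0 vr; rewrite (_ : `|v| = mx_norm v)// mx_normrE;
  apply: bigmax_le => // -[i j] _; rewrite (ord1 j).
Qed.

Lemma mxnorm_oo_ge0 m n (M : 'M[R]_(m, n)) : 0 <= mxnorm_oo M.
Proof. exact: bigmax_ge_id. Qed.

Lemma norm_mulmx_le m n (M : 'M[R]_(m, n)) (v : 'cV[R]_n) :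
  `|M *m v| <= mxnorm_oo M * `|v|.
Proof.
apply: cV_norm_le => [|i]; first by rewrite mulr_ge0 ?mxnorm_oo_ge0.
rewrite mxE; apply: (le_trans (ler_norm_sum _ _ _)).
apply: (@le_trans _ _ ((\sum_j `|M i j|) * `|v|)).
  rewrite mulr_suml; apply: ler_sum => j _.
  by rewrite normrM ler_wpM2l// ler_coord_norm.
rewrite ler_wpM2r//; exact: (le_bigmax _ (fun i => \sum_j `|M i j|) i).
Qed.

(** A kernel vector satisfies [v = - (M - 1) v], whose norm would be strictly smaller than that of
    [v] unless [v = 0]. The transposes only serve to pass to row freeness. *)
Lemma mxnorm_oo_sub1_unitmx n (M : 'M[R]_n) :
  mxnorm_oo (M - 1%:M) < 1 -> M \in unitmx.
Proof.
move=> M1; rewrite -unitmx_tr -row_free_unit; apply: inj_row_free => v vM.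
have Mv : M *m v^T = 0 by rewrite -[M]trmxK -trmx_mul vM trmx0.
have E : `|v^T| <= mxnorm_oo (M - 1%:M) * `|v^T|.
  rewrite -[X in `|X| <= _]opprK -[X in - X](_ : (M - 1%:M) *m v^T = _).
    by rewrite normrN norm_mulmx_le.
  by rewrite mulmxBl Mv mul1mx sub0r.
have /eqP : `|v^T| = 0.
  apply/eqP; rewrite eq_le normr_ge0 andbT leNgt; apply/negP => v0.
  by move: E; rewrite ler_pMl// leNgt M1.
by rewrite normr_eq0 => /eqP v0; rewrite -[v]trmxK v0 trmx0.
Qed.

End cV_norm.

Section affine_perturbation.
Context {R : realType} {d : nat}.
Implicit Types (Q : dyadic_cube d) (x y : 'cV[R]_d) (A : 'M[R]_d) (eta : R).
Local Notation side := (@side R d).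
Local Notation center := (@cube_center R d).

Lemma side_gt0 Q : 0 < side Q. Proof. by rewrite exprz_gt0. Qed.
Hint Resolve side_gt0 : core.

(** The argument of [haar h0 g] in [perturbed_haar]. For [A = 1] and [y = 0] it is the identity, so
    both terms of the difference fall under the same lemmas. *)
Definition perturb Q A y x : 'cV[R]_d :=
  center Q + A *m (side Q *: y + x - center Q).

Lemma perturb_id Q x : perturb Q 1%:M 0 x = x.
Proof. by rewrite /perturb mul1mx scaler0 add0r addrC subrK. Qed.

Definition near_id A y eta := mxnorm_oo (A - 1%:M) + `|y| <= eta.

Lemma near_id1 eta : 0 <= eta -> near_id 1%:M 0 eta.
Proof.
move=> eta0; rewrite /near_id subrr normr0 addr0.
by apply: bigmax_le => // i _; rewrite big1// => j _; rewrite mxE normr0.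
Qed.

Lemma near_id_unitmx A y eta : near_id A y eta -> eta <= 8^-1 -> A \in unitmx.
Proof.
move=> nA eta8; apply: mxnorm_oo_sub1_unitmx.
by move: nA; rewrite /near_id; have := normr_ge0 y; lra.
Qed.

Lemma perturbB Q A y x x' : perturb Q A y x - perturb Q A y x' = A *m (x - x').
Proof.
rewrite /perturb opprD addrACA subrr add0r -mulmxBr; congr (_ *m _).
by apply/colP => i; rewrite !mxE; ring.
Qed.

Lemma norm_perturbB Q A y eta x x' : near_id A y eta -> eta <= 8^-1 ->
  `|perturb Q A y x - perturb Q A y x'| <= 2 * `|x - x'|.
Proof.
move=> nA eta8; rewrite perturbB -[A in A *m _](subrK 1%:M) mulmxDl mul1mx.
apply: (le_trans (ler_normD _ _)).
have := norm_mulmx_le (A - 1%:M) (x - x').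
have := mxnorm_oo_ge0 (A - 1%:M); have := normr_ge0 y; have := normr_ge0 (x - x').
by move: nA; rewrite /near_id; nra.
Qed.

(** The displacement is (A - 1)(x - c) + l(Q) A y, with A y of norm at most 2 eta. Where x is within
    l(Q) of the center c, this gives 3 eta l(Q), the half-width of [slab]. *)
Lemma norm_perturb_sub Q A y eta x : near_id A y eta -> eta <= 8^-1 ->
  `|perturb Q A y x - x| <= eta * `|x - center Q| + 2 * (eta * side Q).
Proof.
move=> nA eta8.
have -> : perturb Q A y x - x = (A - 1%:M) *m (x - center Q) + side Q *: (A *m y).
  rewrite /perturb -(addrA (side Q *: y)) mulmxDr -scalemxAr mulmxBl mul1mx.
  by apply/colP => i; rewrite !mxE; ring.
apply: (le_trans (ler_normD _ _)).
have y0 := normr_ge0 y; have A0 := mxnorm_oo_ge0 (A - 1%:M).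
have Ay : `|A *m y| <= 2 * eta.
  rewrite -[A in A *m _](subrK 1%:M) mulmxDl mul1mx.
  apply: (le_trans (ler_normD _ _)); have := norm_mulmx_le (A - 1%:M) y.
  by move: nA; rewrite /near_id; nra.
rewrite normrZ (gtr0_norm (side_gt0 _)); apply: lerD.
  apply: (le_trans (norm_mulmx_le _ _)); rewrite ler_wpM2r//.
  by move: nA; rewrite /near_id; lra.
by rewrite mulrA mulrC ler_wpM2r// ltW.
Qed.

(** With [eta <= 1/8] the displacement is at most |x - c|/8 + l(Q)/4. Absorbing the first term
    leaves |x - c| <= 6/7 l(Q). *)
Lemma perturb_near_center Q A y eta x : near_id A y eta -> eta <= 8^-1 ->
  `|perturb Q A y x - center Q| <= side Q / 2 -> `|x - center Q| <= side Q.
Proof.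
move=> nA eta8 tx.
have := norm_perturb_sub Q x nA eta8; have := side_gt0 Q.
have := ler_normB (perturb Q A y x - center Q) (perturb Q A y x - x).
rewrite (_ : _ - center Q - _ = x - center Q); last by apply/colP => i; rewrite !mxE; ring.
have := normr_ge0 (x - center Q).
by move: tx; nra.
Qed.

(** On a line parallel to axis [i], the [i]-th coordinate of the image is affine with slope [A i i],
    at least 7/8. This is the transversality that limits how many cubes of one column lie close to a
    tilted hyperplane. *)
Lemma perturb_diag Q A y eta x x' i : near_id A y eta -> eta <= 8^-1 ->
  (forall j, j != i -> x j ord0 = x' j ord0) ->
  `|x i ord0 - x' i ord0| <=
  2 * `|perturb Q A y x i ord0 - perturb Q A y x' i ord0|.
Proof.
move=> nA eta8 xx'.
have -> : perturb Q A y x i ord0 - perturb Q A y x' i ord0 =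
    A i i * (x i ord0 - x' i ord0).
  transitivity ((perturb Q A y x - perturb Q A y x') i ord0); first by rewrite !mxE.
  rewrite perturbB mxE (bigD1 i)//= big1 ?addr0 ?mxE// => j ji.
  by rewrite !mxE xx'// subrr mulr0.
have Aii : `|A i i - 1| <= 8^-1.
  apply: (@le_trans _ _ (\sum_j `|(A - 1%:M) i j|)).
    by rewrite (bigD1 i)//= !mxE eqxx lerDl sumr_ge0.
  apply: (@le_trans _ _ (mxnorm_oo (A - 1%:M))).
    exact: (le_bigmax _ (fun i => \sum_j `|(A - 1%:M) i j|) i).
  by move: nA; rewrite /near_id; have := normr_ge0 y; lra.
rewrite normrM mulrA ler_peMl//.
have : 7 / 8 <= A i i by move: Aii; rewrite ler_norml => /andP[]; lra.
by move=> Ai; rewrite ger0_norm; lra.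
Qed.

End affine_perturbation.

(** * Haar functions in coordinates rescaled to the unit cube *)

Section haar_pointwise.
Context {R : realType} {d : nat}.
Implicit Types (Q : dyadic_cube d) (x : 'cV[R]_d) (u : 'I_d -> R -> R).
Local Notation side := (@side R d).
Local Notation center := (@cube_center R d).

Definition loc Q x i : R := 2 ^ (- Q.1) * x i ord0 - (Q.2 i)%:~R.

(* The hyperplanes [x i = grid Q i k] contain the discontinuities of the Haar
   functions of [Q]. *)
Definition grid Q i (k : 'I_3) : R := ((Q.2 i)%:~R + k%:R / 2) * side Q.

Definition cell_prod u Q x : R := \prod_i u i (loc Q x i).

(** Common ground of [chi01], [h01] and [half01], enough for the measurability, size and support of
    products of them. *)
Definition cell_fun (v : R -> R) := [/\ measurable_fun setT v,
  (forall t, `|v t| <= 1) & forall t, v t != 0 -> 0 <= t < 1].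

Lemma locE Q x i : x i ord0 = (loc Q x i + (Q.2 i)%:~R) * side Q.
Proof. by rewrite /loc subrK mulrAC -expfzDr ?pnatr_eq0// addNr expr0z mul1r. Qed.

Lemma loc_grid Q x i k : `|x i ord0 - grid Q i k| = `|loc Q x i - k%:R / 2| * side Q.
Proof.
rewrite (locE Q) /grid -mulrBl normrM (gtr0_norm (side_gt0 _)).
by congr (`|_| * _); ring.
Qed.

Lemma locB Q x x' i : `|x i ord0 - x' i ord0| = `|loc Q x i - loc Q x' i| * side Q.
Proof.
rewrite !(locE Q _ i) -mulrBl normrM (gtr0_norm (side_gt0 _)).
by congr (`|_| * _); ring.
Qed.

Lemma loc_center Q x i :
  `|x i ord0 - center Q i ord0| = `|loc Q x i - 2^-1| * side Q.
Proof.
rewrite (locE Q) mxE intrD (_ : _ / 2 = (2^-1 + (Q.2 i)%:~R) * side Q); last by field.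
by rewrite -mulrBl normrM (gtr0_norm (side_gt0 _)); congr (`|_| * _); ring.
Qed.

Lemma measurable_loc Q i : measurable_fun setT (fun x : 'cV[R]_d => loc Q x i).
Proof.
apply: measurable_funB; last exact: measurable_cst.
by apply: measurable_funM; [exact: measurable_cst|exact: measurable_coord].
Qed.

Lemma measurable_cell_prod u Q :
  (forall i, cell_fun (u i)) -> measurable_fun setT (cell_prod u Q).
Proof.
move=> cu; apply: measurable_prod => i _; have [mu _ _] := cu i.
exact: measurableT_comp mu (measurable_loc Q i).
Qed.

Lemma cell_prod_le1 u Q x : (forall i, cell_fun (u i)) -> `|cell_prod u Q x| <= 1.
Proof.
move=> cu; rewrite normr_prod; apply: prodr_ile1 => i _.
by rewrite normr_ge0; have [_ ->] := cu i.
Qed.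

Lemma cell_prod_supp u Q x : (forall i, cell_fun (u i)) ->
  cell_prod u Q x != 0 -> `|x - center Q| <= side Q / 2.
Proof.
move=> cu /prodf_neq0 ux; apply: cV_norm_le => [|i].
  by rewrite divr_ge0// ltW// side_gt0.
have [_ _ /(_ _ (ux i isT))] := cu i => /andP[t0 t1].
have -> : (x - center Q) i ord0 = x i ord0 - center Q i ord0 by rewrite !mxE.
rewrite loc_center mulrC ler_pM2l ?side_gt0// ler_norml; lra.
Qed.

Definition half01 : R -> R := \1_`[0, 2^-1[%classic.

Lemma indic_itvcoE (a b t : R) : \1_(`[a, b[%classic) t = (a <= t < b)%R%:R :> R.
Proof.
by rewrite indicE; congr ((nat_of_bool _)%:R); apply/idP/idP; rewrite inE /= in_itv.
Qed.

Lemma cell_fun_indic (a b : R) : 0 <= a -> b <= 1 -> cell_fun (\1_`[a, b[%classic).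
Proof.
move=> a0 b1; split=> [|t|t].
- exact: measurable_indic.
- by rewrite indicE; case: (_ \in _); rewrite ?normr1 ?normr0.
- rewrite indic_itvcoE; case: (boolP (a <= t < b)%R); last by rewrite eqxx.
  move=> /andP[at_ tb] _.
  by rewrite (le_trans a0)// (lt_le_trans tb).
Qed.

Lemma chi01E t : @chi01 R t = (0 <= t < 1)%R%:R.
Proof. exact: indic_itvcoE. Qed.

Lemma half01E t : half01 t = (0 <= t < 2^-1)%R%:R.
Proof. exact: indic_itvcoE. Qed.

Lemma h01E t : @h01 R t = (0 <= t < 2^-1)%R%:R - (2^-1 <= t < 1)%R%:R.
Proof. by rewrite /h01/= !indic_itvcoE. Qed.

Lemma h01_half t : @h01 R t = half01 t - half01 (t - 2^-1).
Proof.
rewrite h01E !half01E; congr (_ - _%:R).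
by rewrite subr_ge0 ltrBlDr; congr (_ && (_ < _)); lra.
Qed.

Lemma cell_fun_chi01 : cell_fun (@chi01 R). Proof. exact: cell_fun_indic. Qed.

Lemma cell_fun_half01 : cell_fun half01.
Proof. by apply: cell_fun_indic => //; lra. Qed.

Lemma cell_fun_h01 : cell_fun (@h01 R).
Proof.
split=> [|t|t].
- by apply: measurable_funB; apply: measurable_indic.
- rewrite h01E; case: (boolP (0 <= t < 2^-1)) => [/andP[? ?]|_];
    case: (boolP (2^-1 <= t < 1)) => [/andP[? ?]|_];
    rewrite ?subr0 ?sub0r ?subrr ?normrN ?normr1 ?normr0//.
- rewrite h01E; case: (boolP (0 <= t < _)) => [/andP[? ?] _|_]; first by lra.
  case: (boolP (2^-1 <= t < _)) => [/andP[? ?] _|_]; first by lra.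
  by rewrite subrr eqxx.
Qed.

(** Both functions jump only at 0, 1/2 and 1. If a value changes between [s] and [t], one of these
    points separates them and is therefore no farther from [s] than [t] is. *)
Lemma cell_sep (s t : R) : (chi01 s != chi01 t) || (h01 s != h01 t) ->
  exists k : 'I_3, `|s - k%:R / 2| <= `|s - t|.
Proof.
have sep (b : R) : (s < b) != (t < b) -> `|s - b| <= `|s - t|.
  case: (ltP s b); case: (ltP t b) => // tb sb _.
    by rewrite !ler0_norm; lra.
  by rewrite !ger0_norm; lra.
have [s0|/sep] := eqVneq (s < 0) (t < 0); last first.
  by exists (inord 0); rewrite inordK// mul0r.
have [s1|/sep] := eqVneq (s < 2^-1) (t < 2^-1); last first.
  by exists (inord 1); rewrite inordK// mul1r.
have [s2|/sep] := eqVneq (s < 1) (t < 1); last first.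
  by exists (inord 2); rewrite inordK// divff.
by rewrite !chi01E !h01E !leNgt s0 s1 s2 !eqxx.
Qed.

(* [|Q|^(-1/2)] *)
Definition amp Q : R := 2 `^ (- (Q.1%:~R * d%:R) / 2).

Lemma amp_gt0 Q : 0 < amp Q. Proof. exact: powR_gt0. Qed.

Lemma amp_ge0 Q : 0 <= amp Q. Proof. exact: powR_ge0. Qed.

Variable h0 : haar_label d -> 'cV[R]_d -> R.
Hypothesis h0E : haar_enumeration h0.
Implicit Type g : haar_index d.

Definition haar_factor (S : {set 'I_d}) i : R -> R := if i \in S then h01 else chi01.

Lemma cell_fun_haar_factor S i : cell_fun (haar_factor S i).
Proof. by rewrite /haar_factor; case: ifP => _; [exact: cell_fun_h01|exact: cell_fun_chi01]. Qed.

Lemma haarE g : exists2 S : {set 'I_d}, S != finset.set0 &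
  forall x, haar h0 g x = amp g.1 * cell_prod (haar_factor S) g.1 x.
Proof.
have [h0k _ _] := h0E.
have [S S0 /= Sk] := h0k g.2 I.
exists S => // x; rewrite /haar -Sk; congr (_ * _); apply: eq_bigr => i _.
by rewrite !mxE /haar_factor /loc; case: ifP.
Qed.

Lemma measurable_haar g : measurable_fun setT (haar h0 g).
Proof.
have [S _ hE] := haarE g; rewrite (funext hE).
apply: measurable_funM; first exact: measurable_cst.
by apply: measurable_cell_prod => i; exact: cell_fun_haar_factor.
Qed.

Lemma haar_le_amp g x : `|haar h0 g x| <= amp g.1.
Proof.
have [S _ ->] := haarE g; rewrite normrM (gtr0_norm (amp_gt0 _)) ler_piMr ?amp_ge0//.
by apply: cell_prod_le1 => i; exact: cell_fun_haar_factor.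
Qed.

Lemma haar_supp g x : haar h0 g x != 0 -> `|x - center g.1| <= side g.1 / 2.
Proof.
have [S _ ->] := haarE g; rewrite mulf_eq0 negb_or => /andP[_].
by apply: cell_prod_supp => i; exact: cell_fun_haar_factor.
Qed.

(** A product can change only if a factor does. The lemma serves twice: with [x'] the perturbed
    image of [x] it confines the support of [err] to slabs, and with two images under one map it
    yields [near_grid]. *)
Lemma haar_neq_grid g x x' : haar h0 g x != haar h0 g x' ->
  exists i k, `|x i ord0 - grid g.1 i k| <= `|x i ord0 - x' i ord0|.
Proof.
have [S _ hE] := haarE g; rewrite !hE => xx'.
have [i xi] : exists i, haar_factor S i (loc g.1 x i) != haar_factor S i (loc g.1 x' i).
  apply/existsP; apply: contraNT xx' => /existsPn h.
  by apply/eqP; congr (_ * _); apply: eq_bigr => i _; apply/eqP; rewrite -[_ == _]negbK.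
have [k kP] : exists k : 'I_3, `|loc g.1 x i - k%:R / 2| <= `|loc g.1 x i - loc g.1 x' i|.
  apply: cell_sep; move: xi; rewrite /haar_factor.
  by case: ifP => _ ->; rewrite ?orbT.
exists i, k; rewrite loc_grid (locB g.1) ler_wpM2r//.
by rewrite ltW ?side_gt0.
Qed.

(** As [S] is nonempty, some factor is [h01], that is, [half01] minus its shift by 1/2. So [phi]
    carries [half01] on that axis [i0], and [w] is half a side along it. *)
Lemma haar_split g : exists (phi : 'cV[R]_d -> R) (w : 'cV[R]_d),
  [/\ measurable_fun setT phi, forall x, `|phi x| <= amp g.1,
      (forall x, phi x != 0 -> `|x - center g.1| <= side g.1 / 2) &
      forall x, haar h0 g x = phi x - phi (x - w)].
Proof.
have [S /finset.set0Pn[i0 Si0] hE] := haarE g.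
pose u i := if i == i0 then half01 else haar_factor S i.
have cu i : cell_fun (u i).
  by rewrite /u; case: eqP => _; [exact: cell_fun_half01|exact: cell_fun_haar_factor].
exists (fun x => amp g.1 * cell_prod u g.1 x), ((side g.1 / 2) *: delta_mx i0 ord0).
split=> [|x|x|x].
- by apply: measurable_funM; [exact: measurable_cst|exact: measurable_cell_prod].
- by rewrite normrM (gtr0_norm (amp_gt0 _)) ler_piMr ?amp_ge0// cell_prod_le1.
- by rewrite mulf_eq0 negb_or => /andP[_]; exact: cell_prod_supp.
rewrite hE -mulrBr; congr (_ * _); rewrite /cell_prod.
rewrite (bigD1 i0)//= [X in _ = X - _](bigD1 i0)//= [X in _ = _ - X](bigD1 i0)//=.
have locw i : loc g.1 (x - (side g.1 / 2) *: delta_mx i0 ord0) i =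
    loc g.1 x i - (i == i0)%:R / 2.
  have side1 : 2 ^ (- g.1.1) * side g.1 = 1 by rewrite -expfzDr ?pnatr_eq0// addNr.
  rewrite /loc !mxE eqxx andbT.
  move: side1; move: (2 ^ (- g.1.1)) (side g.1) (i == i0)%:R (x i ord0) (g.1.2 i)%:~R.
  move=> a b e t j ab1.
  transitivity (a * t - a * b * e / 2 - j); first by ring.
  by rewrite ab1; ring.
have tail : \prod_(i | i != i0) u i (loc g.1 x i) =
    \prod_(i | i != i0) haar_factor S i (loc g.1 x i).
  by apply: eq_bigr => i /negbTE ii0; rewrite /u ii0.
have tailw : \prod_(i | i != i0) u i (loc g.1 (x - (side g.1 / 2) *: delta_mx i0 ord0) i) =
    \prod_(i | i != i0) haar_factor S i (loc g.1 x i).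
  rewrite -tail; apply: eq_bigr => i /negbTE ii0.
  by rewrite locw ii0 mul0r subr0.
rewrite tail tailw locw eqxx mul1r -mulrBl; congr (_ * _).
by rewrite /u eqxx -h01_half /haar_factor Si0.
Qed.

End haar_pointwise.

(** * Integrability of bounded functions with bounded support *)

Section box.
Context {R : realType} {d : nat}.
Local Notation leb := (@lebesgue_cV R d).

Definition box (a b : 'I_d -> R) : set 'cV[R]_d :=
  [set x | forall i, `[a i, b i]%classic (x i ord0)].

Lemma measurable_box a b : measurable (box a b).
Proof.
rewrite (_ : box a b = \bigcap_(i in [set: 'I_d])
    ((fun v : 'cV[R]_d => v i ord0) @^-1` `[a i, b i]%classic)).
  apply: fin_bigcap_measurable => // i _; rewrite -[X in measurable X]setTI.
  exact: measurable_coord.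
by apply/seteqP; split=> [v Av i _|v Av i]; [exact: Av|exact: (Av i)].
Qed.

Lemma lebesgue_box a b : (forall i, a i <= b i) ->
  leb (box a b) = (\prod_i (b i - a i))%:E.
Proof.
move=> ab; rewrite (@lebesgue_cV_box R d (fun i => `[a i, b i]%classic))//.
rewrite -prodEFin; apply: eq_bigr => i _.
rewrite lebesgue_measure_itv /= lte_fin; case: ltP => // ba.
by rewrite (_ : b i = a i) ?subrr//; apply/le_anti; rewrite ba ab.
Qed.

Lemma integrable_bounded_supp (F : 'cV[R]_d -> R) (c : 'cV[R]_d) (r K : R) :
  measurable_fun setT F -> (forall x, `|F x| <= K) ->
  (forall x, F x != 0 -> `|x - c| <= r) -> leb.-integrable setT (EFin \o F).
Proof.
move=> mF FK Fr.
(* A negative radius forces [F = 0]; otherwise [F] is dominated by [K] times the indicator of a box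
   of finite measure. *)
have [r0|r0] := leP 0 r; last first.
  have F0 : F = cst 0.
    apply/funext => x; apply/eqP; apply: contraT => /Fr xr.
    by have := le_trans (normr_ge0 _) xr; rewrite leNgt r0.
  by rewrite F0; have := integrable0 leb setT; exact: eq_integrable.
pose B := box (fun i => c i ord0 - r) (fun i => c i ord0 + r).
have Boo : (leb B < +oo)%E by rewrite lebesgue_box ?ltry// => i; lra.
have i1 : leb.-integrable setT (EFin \o \1_B).
  apply/integrableP; split.
    by apply/measurable_EFinP; apply: measurable_indic; exact: measurable_box.
  under eq_integral do rewrite /= ger0_norm//.
  by rewrite integral_indic ?setIT//; exact: measurable_box.
have iB := integrableZl measurableT K i1.
have K0 : 0 <= K by exact: le_trans (normr_ge0 _) (FK 0).
apply: le_integrable iB => //; first exact/measurable_EFinP.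
move=> x _ /=; rewrite lee_fin [leRHS]ger0_norm ?mulr_ge0// indicE.
have [->|Fx] := eqVneq (F x) 0; first by rewrite normr0 mulr_ge0.
rewrite mem_set ?mulr1// => i /=; rewrite in_itv/=.
have := le_trans (ler_coord_norm (x - c) i) (Fr _ Fx).
by rewrite !mxE ler_norml; lra.
Qed.

Lemma sqint_bounded_supp (F : 'cV[R]_d -> R) (c : 'cV[R]_d) (r K : R) :
  measurable_fun setT F -> (forall x, `|F x| <= K) ->
  (forall x, F x != 0 -> `|x - c| <= r) -> sqint leb F.
Proof.
move=> mF FK Fr; split=> //.
apply: (@integrable_bounded_supp _ c r (K ^+ 2)) => [|x|x].
- exact: measurable_funX.
- by rewrite normrX lerXn2r// nnegrE// (le_trans _ (FK x)).
- by rewrite sqrf_eq0; exact: Fr.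
Qed.

End box.

Section perturbed_haar_integral.
Context {R : realType} {d : nat}.
Local Notation leb := (@lebesgue_cV R d).
Local Notation side := (@side R d).
Local Notation center := (@cube_center R d).
Variable h0 : haar_label d -> 'cV[R]_d -> R.
Hypothesis h0E : haar_enumeration h0.
Implicit Types (Q : dyadic_cube d) (x y : 'cV[R]_d) (A : 'M[R]_d) (g : haar_index d).

Lemma measurable_perturb Q A y : measurable_fun setT (perturb Q A y).
Proof.
apply/measurable_fun_coordP => i.
rewrite (_ : (fun x => _) = (fun x => center Q i ord0 +
    \sum_j A i j * (side Q * y j ord0 + x j ord0 - center Q j ord0))); last first.
  apply/funext => x; rewrite !mxE; congr (_ + _).
  by apply: eq_bigr => j _; rewrite !mxE.
apply: measurable_funD; first exact: measurable_cst.
apply: measurable_sum => j; apply: measurable_funM; first exact: measurable_cst.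
apply: measurable_funB; last exact: measurable_cst.
by apply: measurable_funD; [exact: measurable_cst|exact: measurable_coord].
Qed.

(* A Haar function is a difference of two translates of some [phi], and the
   perturbation turns translates into translates, so translation invariance
   of the measure suffices. *)
Lemma Rintegral_haar_perturb g A y eta : near_id A y eta -> eta <= 8^-1 ->
  Rintegral leb setT (fun x => haar h0 g (perturb g.1 A y x)) = 0.
Proof.
move=> nA eta8; have uA := near_id_unitmx nA eta8.
have [phi [w [mphi phiK phis hE]]] := haar_split h0E g.
pose f x := phi (perturb g.1 A y x).
have mf : measurable_fun setT f by exact: measurableT_comp mphi (measurable_perturb _ _ _).
have fi : leb.-integrable setT (EFin \o f).
  apply: (@integrable_bounded_supp _ _ f (center g.1) (side g.1) (amp g.1)) => //.
    by move=> x; exact: phiK.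
  by move=> x /phis; exact: perturb_near_center nA eta8.
(* [perturb] has linear part [A], so a shift of its value by [w] is a shift of its argument by
   [invmx A *m w]. *)
have [fvi fvE] := Rintegral_translate (- (invmx A *m w)) mf fi.
transitivity (Rintegral leb setT (fun x => f x - f (x - invmx A *m w))).
  apply: eq_Rintegral => x _; rewrite hE /f; congr (_ - phi _).
  have E : perturb g.1 A y x - perturb g.1 A y (x - invmx A *m w) = w.
    by rewrite perturbB opprB addrC subrK mulmxA mulmxV// mul1mx.
  by rewrite -[in LHS]E opprB addrC subrK.
by rewrite RintegralB// fvE subrr.
Qed.

End perturbed_haar_integral.

(** * Support, mean and L^1 norm of the perturbation errors *)

Section perturbation_error.
Context {R : realType} {d : nat}.
Local Notation leb := (@lebesgue_cV R d.+1).
Local Notation side := (@side R d.+1).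
Local Notation center := (@cube_center R d.+1).
Variable h0 : haar_label d.+1 -> 'cV[R]_d.+1 -> R.
Hypothesis h0E : haar_enumeration h0.
Variables (A : haar_index d.+1 -> 'M[R]_d.+1) (y : haar_index d.+1 -> 'cV[R]_d.+1).
Variable eta : R.
Hypotheses (eta0 : 0 <= eta) (eta8 : eta <= 8^-1).
Hypothesis nA : forall g, near_id (A g) (y g) eta.
Implicit Type g : haar_index d.+1.

Definition err g x := haar h0 g x - perturbed_haar h0 A y g x.

Lemma perturbed_haarE g x :
  perturbed_haar h0 A y g x = haar h0 g (perturb g.1 (A g) (y g) x).
Proof. by []. Qed.

Lemma measurable_err g : measurable_fun setT (err g).
Proof.
apply: measurable_funB; first exact: measurable_haar.
apply: measurableT_comp (measurable_haar h0E g) (measurable_perturb _ _ _).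
Qed.

Lemma err_le g x : `|err g x| <= 2 * amp g.1.
Proof.
apply: (le_trans (ler_normB _ _)); rewrite perturbed_haarE.
have := haar_le_amp h0E g x; have := haar_le_amp h0E g (perturb g.1 (A g) (y g) x); lra.
Qed.

Lemma err_supp g x : err g x != 0 -> `|x - center g.1| <= side g.1.
Proof.
have [hx|hx _] := eqVneq (haar h0 g x) 0; last first.
  by apply: le_trans (haar_supp h0E hx) _; have := side_gt0 (R := R) g.1; lra.
rewrite /err hx sub0r oppr_eq0 perturbed_haarE => /(haar_supp h0E).
exact: perturb_near_center (nA g) eta8.
Qed.

Lemma sqint_err g : sqint leb (err g).
Proof.
by apply: sqint_bounded_supp (measurable_err g) (err_le g) _ => x; exact: err_supp.
Qed.

Lemma integrable_err g : leb.-integrable setT (EFin \o err g).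
Proof.
by apply: integrable_bounded_supp (measurable_err g) (err_le g) _ => x; exact: err_supp.
Qed.

(** The unperturbed Haar function is the perturbation with [A = 1] and [y = 0], so a single integral
    lemma covers both terms. *)
Lemma Rintegral_err g : Rintegral leb setT (err g) = 0.
Proof.
have int0 B z : near_id B z eta ->
    leb.-integrable setT (EFin \o (fun x => haar h0 g (perturb g.1 B z x))).
  move=> nB; apply: (@integrable_bounded_supp _ _ _ (center g.1) (side g.1) (amp g.1)).
  - exact: measurableT_comp (measurable_haar h0E g) (measurable_perturb _ _ _).
  - by move=> x; exact: haar_le_amp.
  - by move=> x /(haar_supp h0E); exact: perturb_near_center nB eta8.
have E := Rintegral_haar_perturb h0E g (near_id1 eta0) eta8.
have I := int0 _ _ (near_id1 eta0).
have hid : (fun x => haar h0 g (perturb g.1 1%:M 0 x)) = haar h0 g.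
  by apply/funext => x; rewrite perturb_id.
rewrite hid in E I; rewrite RintegralB//; last exact: int0.
by rewrite E (Rintegral_haar_perturb h0E g (nA g) eta8) subrr.
Qed.

(** The part of a neighbourhood of a grid hyperplane that can meet the support of [err g]; the
    half-width is the largest displacement there. *)
Definition slab g (ik : 'I_d.+1 * 'I_3) : set 'cV[R]_d.+1 :=
  box (fun l => if l == ik.1 then grid g.1 l ik.2 - 3 * (eta * side g.1)
                else center g.1 l ord0 - side g.1)
      (fun l => if l == ik.1 then grid g.1 l ik.2 + 3 * (eta * side g.1)
                else center g.1 l ord0 + side g.1).

Lemma lebesgue_slab g ik :
  leb (slab g ik) = (6 * eta * 2 ^+ d * side g.1 ^+ d.+1)%:E.
Proof.
have s0 := side_gt0 (R := R) g.1.
rewrite lebesgue_box => [|l]; last first.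
  case: eqP => _; last by lra.
  have : 0 <= eta * side g.1 by rewrite mulr_ge0// ltW.
  by lra.
rewrite (bigD1 ik.1)//= eqxx (eq_bigr (fun=> 2 * side g.1)); last first.
  by move=> l /negbTE ->; ring.
rewrite prodr_const (_ : #|_| = d); last first.
  by rewrite cardC1 card_ord.
by rewrite exprMn exprS; congr EFin; ring.
Qed.

Lemma err_slab g x : err g x != 0 -> exists ik, slab g ik x.
Proof.
move=> ex; have xc := err_supp ex.
have : haar h0 g x != haar h0 g (perturb g.1 (A g) (y g) x) by rewrite -subr_eq0.
move=> /(haar_neq_grid h0E)[i [k ik]]; exists (i, k) => l /=.
have s0 := side_gt0 (R := R) g.1.
case: eqP => [->|_]; rewrite in_itv/=; last first.
  have := le_trans (ler_coord_norm _ l) xc.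
  by rewrite !mxE ler_norml; lra.
have h2 := norm_perturb_sub g.1 x (nA g) eta8.
have h1 := ler_coord_norm (perturb g.1 (A g) (y g) x - x) i.
have : `|x i ord0 - grid g.1 i k| <= 3 * (eta * side g.1).
  apply: (le_trans ik); rewrite distrC.
  rewrite (_ : perturb _ _ _ _ i _ - _ = (perturb g.1 (A g) (y g) x - x) i ord0);
    last by rewrite !mxE.
  apply: (le_trans h1); apply: (le_trans h2).
  by have := ler_wpM2l eta0 xc; lra.
by rewrite ler_norml; lra.
Qed.

(** The function is dominated by its supremum [2 * amp] times the sum of the indicators of the
    [d.+1 * 3] slabs, which all have the same measure. *)
Lemma err_L1 g : Rintegral leb setT (fun x => `|err g x|) <=
  2 * amp g.1 * (d.+1 * 3)%:R * (6 * eta * 2 ^+ d * side g.1 ^+ d.+1).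
Proof.
have a0 := amp_ge0 (R := R) g.1.
pose F x : R := 2 * amp g.1 * \sum_ik \1_(slab g ik) x.
have eF x : `|err g x| <= F x.
  have S0 : 0 <= \sum_ik \1_(slab g ik) x :> R by apply: sumr_ge0.
  have [->|ex] := eqVneq (err g x) 0; first by rewrite normr0 /F mulr_ge0// mulr_ge0.
  apply: (le_trans (err_le _ _)); rewrite /F ler_peMr ?mulr_ge0//.
  have [ik xik] := err_slab ex; rewrite (bigD1 ik)//= indicE mem_set// lerDl.
  by apply: sumr_ge0.
have m1 ik : measurable_fun setT (\1_(slab g ik) : _ -> R).
  by apply: measurable_indic; exact: measurable_box.
have mS : measurable_fun setT (fun x => \sum_ik \1_(slab g ik) x : R).
  exact: measurable_sum.
have intF : (\int[leb]_x (F x)%:E =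
    (2 * amp g.1 * (d.+1 * 3)%:R * (6 * eta * 2 ^+ d * side g.1 ^+ d.+1))%:E)%E.
  rewrite /F; under eq_integral do rewrite EFinM.
  rewrite ge0_integralZl//; last 3 first.
  - exact/measurable_EFinP.
  - by move=> x _; rewrite lee_fin; apply: sumr_ge0.
  - by rewrite lee_fin mulr_ge0.
  under eq_integral do rewrite -sumEFin.
  rewrite ge0_integral_sum//; last by move=> ik; exact/measurable_EFinP.
  rewrite (eq_bigr (fun=> (6 * eta * 2 ^+ d * side g.1 ^+ d.+1)%:E)).
    rewrite sumEFin -EFinM sumr_const card_prod !card_ord; congr EFin.
    by rewrite -[X in _ * X]mulr_natl mulrA.
  move=> ik _; rewrite integral_indic ?setIT//; first exact: lebesgue_slab.
  exact: measurable_box.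
have int_err : leb.-integrable setT (EFin \o (fun x => `|err g x|)).
  have := integrable_abse (integrable_err g); exact: eq_integrable.
rewrite -lee_fin /Rintegral fineK ?integrable_fin_num//.
rewrite -intF; apply: ge0_le_integral => //.
- by apply/measurable_EFinP; apply: measurableT_comp => //; exact: measurable_err.
- by apply/measurable_EFinP; apply: measurable_funM => //; exact: measurable_cst.
- by move=> x _; rewrite lee_fin.
Qed.

End perturbation_error.

(** * Gram matrix of the perturbation errors *)

Section counting.
Context {d : nat}.

Lemma eq_of_eqmod (N a b : int) : (a = b %[mod N])%Z -> `|a - b| < N -> a = b.
Proof.
move=> /eqP; rewrite eqz_mod_dvd => /dvdzP[k ab]; rewrite ab => kN.
apply/eqP; rewrite -subr_eq0 ab; have [->|k0] := eqVneq k 0; first by rewrite mul0r.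
move: kN; have := normr_gt0 k; rewrite k0 normrM => k1.
have : N <= `|N| by exact: ler_norm.
have := normr_ge0 N; nia.
Qed.

Definition resid (N : nat) (a : int) : 'I_N.+1 := inord `|(a %% N.+1%:Z)%Z|%N.

Lemma resid_inj N a b : resid N a = resid N b -> `|a - b| < N.+1%:Z -> a = b.
Proof.
move=> rab; apply: eq_of_eqmod.
have lt c : (`|(c %% N.+1%:Z)%Z| < N.+1)%N.
  by have := ltz_pmod c (isT : 0 < N.+1%:Z); have := modz_ge0 c (isT : N.+1%:Z != 0); lia.
have := congr1 val rab; rewrite /= !inordK//.
by have := modz_ge0 a (isT : N.+1%:Z != 0); have := modz_ge0 b (isT : N.+1%:Z != 0); lia.
Qed.

(* Such indices are determined by their residues mod [N + 1]; along the axis [i]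
   the residue mod 9 suffices. *)
Lemma size_haar_index_le (n : int) (N : nat) (i : 'I_d.+1) (s : seq (haar_index d.+1)) :
  uniq s -> (forall g, g \in s -> g.1.1 = n) ->
  (forall g g' l, g \in s -> g' \in s -> `|g.1.2 l - g'.1.2 l| < N.+1%:Z) ->
  (forall g g', g \in s -> g' \in s -> (forall l, l != i -> g.1.2 l = g'.1.2 l) ->
     `|g.1.2 i - g'.1.2 i| < 9%:Z) ->
  (size s <= N.+1 ^ d * 9 * 2 ^ d.+1)%N.
Proof.
move=> us sn sN s9.
pose phi (g : haar_index d.+1) : {ffun 'I_d -> 'I_N.+1} * 'I_9 * 'I_(2 ^ d.+1) :=
  ([ffun l => resid N (g.1.2 (lift i l))], resid 8 (g.1.2 i), val g.2).
have phi_inj : {in s &, injective phi}.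
  move=> [[n1 j1] k1] [[n2 j2] k2] gs gs' [].
  move: (sn _ gs) (sn _ gs') (fun l => sN _ _ l gs gs') (s9 _ _ gs gs') => /= -> -> hN h9.
  move=> /ffunP jl ji /val_inj ->; congr (_, _, _); apply/ffunP.
  (* The coordinates off the axis are recovered first: the bound by 9 along [i] is available only
     once they agree. *)
  have jj l : l != i -> j1 l = j2 l.
    case: (unliftP i l) => [l' -> _|->]; last by rewrite eqxx.
    by apply: resid_inj (hN _); have := jl l'; rewrite !ffunE.
  move=> l; have [->|] := eqVneq l i; last exact: jj.
  by apply: resid_inj ji _; exact: h9.
rewrite -(size_map phi); have : uniq (map phi s) by rewrite map_inj_in_uniq.
move=> /card_uniqP <-; apply: (leq_trans (max_card _)).
by rewrite !card_prod card_ffun !card_ord.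
Qed.

Lemma size_le_sum_count (T : Type) (E : finType) (P : E -> pred T) (s : seq T) :
  all (fun x => [exists e, P e x]) s -> (size s <= \sum_e count (P e) s)%N.
Proof.
elim: s => //= x s IHs /andP[/existsP[e Pe] /IHs]; rewrite big_split /= => h.
by rewrite -add1n leq_add// (bigD1 e)//= Pe.
Qed.

End counting.

Section index_distance.
Context {R : realType} {d : nat}.
Local Notation side := (@side R d).
Local Notation center := (@cube_center R d).

Lemma centerB (Q Q' : dyadic_cube d) l : Q.1 = Q'.1 ->
  center Q l ord0 - center Q' l ord0 = (Q.2 l - Q'.2 l)%:~R * side Q.
Proof.
by move=> e; rewrite !mxE /side -e !intrD mulrNz; field.
Qed.

Lemma index_dist (Q Q' : dyadic_cube d) l (N : nat) : Q.1 = Q'.1 ->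
  `|center Q l ord0 - center Q' l ord0| <= N%:R * side Q ->
  `|Q.2 l - Q'.2 l| < N.+1%:Z.
Proof.
move=> e; rewrite centerB// normrM (gtr0_norm (side_gt0 _)) ler_pM2r ?side_gt0//.
by rewrite -intr_norm -[N%:R]/(N%:Z%:~R) ler_int; lia.
Qed.

End index_distance.

(** 72 is 2 * 2 * 3 * 6: the suprema of two errors, the three hyperplanes per axis, and the slab
    thickness [6 * eta]. *)
Definition gram_cst (R : realType) (d : nat) : R := 72 * d.+1%:R * 2 ^+ d.

Section gram.
Context {R : realType} {d : nat}.
Local Notation leb := (@lebesgue_cV R d.+1).
Local Notation side := (@side R d.+1).
Local Notation center := (@cube_center R d.+1).
Local Notation amp := (@amp R d.+1).
Variable h0 : haar_label d.+1 -> 'cV[R]_d.+1 -> R.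
Hypothesis h0E : haar_enumeration h0.
Variables (A : haar_index d.+1 -> 'M[R]_d.+1) (y : haar_index d.+1 -> 'cV[R]_d.+1).
Variable eta : R.
Hypotheses (eta0 : 0 <= eta) (eta8 : eta <= 8^-1).
Hypothesis nA : forall g, near_id (A g) (y g) eta.
Implicit Type g : haar_index d.+1.

Local Notation err := (err h0 A y).

Definition gram g g' : R := Rintegral leb setT (fun x => err g x * err g' x).

Lemma gramC g g' : gram g g' = gram g' g.
Proof. exact: innerC. Qed.

Lemma amp_side g : amp g.1 ^+ 2 * side g.1 ^+ d.+1 = 1.
Proof.
rewrite -powR_mulrn ?amp_ge0// /amp -powRrM mulfVK ?pnatr_eq0// -mulNr.
rewrite powRrM powR_mulrn ?powR_ge0// -exprMn /side -powR_intmul// -powRD ?addNr ?powRr0 ?expr1n//.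
by rewrite pnatr_eq0 implybT.
Qed.

(** Supremum of one error times the L^1 norm of the other. The bound is not symmetric: it is small
    when [g] belongs to the larger cube, and [gramC] arranges this. *)
Lemma gram_le g g' : `|gram g g'| <= gram_cst R d * eta * (amp g.1 / amp g'.1).
Proof.
have a' := amp_gt0 (R := R) g'.1; have a0 := amp_ge0 (R := R) g.1.
have sg := sqint_err h0E eta8 nA.
have ierr := integrable_err h0E eta8 nA.
have iabs : leb.-integrable setT (EFin \o (fun x => `|err g' x|)).
  by have := integrable_abse (ierr g'); exact: eq_integrable.
have iprod := integrable_sqintM (sg g) (sg g').
apply: (le_trans (le_normr_Rintegral _ iprod)) => //.
apply: (@le_trans _ _ (Rintegral leb setT (fun x => 2 * amp g.1 * `|err g' x|))).
  apply: le_Rintegral => //.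
  - by have := integrable_abse iprod; exact: eq_integrable.
  - by have := integrableZl measurableT (2 * amp g.1) iabs; apply: eq_integrable.
  - by move=> x _; rewrite normrM ler_wpM2r// err_le.
rewrite RintegralZl//.
have := ler_wpM2l (mulr_ge0 (ler0n R 2) a0) (err_L1 h0E eta0 eta8 nA g').
move/le_trans; apply; rewrite le_eqVlt; apply/orP; left; apply/eqP.
transitivity (gram_cst R d * eta * (amp g.1 / amp g'.1) * (amp g'.1 ^+ 2 * side g'.1 ^+ d.+1)).
  by rewrite /gram_cst natrM; field; rewrite gt_eqF.
by rewrite amp_side mulr1.
Qed.

Definition tau g (b : bool) x :=
  if b then perturb g.1 (A g) (y g) x else perturb g.1 1%:M 0 x.

(** The radius is the Lipschitz constant 2 of [tau] times the radius of the support of [err g'].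
    Testing only the center gives one point per cube to count. *)
Definition near_grid g (e : bool * 'I_d.+1 * 'I_3) g' :=
  `|tau g e.1.1 (center g'.1) e.1.2 ord0 - grid g.1 e.1.2 e.2| <= 2 * side g'.1.

Lemma tau_nearP g b : exists B z, near_id B z eta /\ tau g b = perturb g.1 B z.
Proof.
by case: b; [exists (A g), (y g)|exists 1%:M, 0; split=> //; exact: near_id1].
Qed.

Lemma err_tau g x : err g x = haar h0 g (tau g false x) - haar h0 g (tau g true x).
Proof. by rewrite /tau perturb_id. Qed.

Lemma gram_neq0_center g g' : gram g g' != 0 ->
  `|center g'.1 - center g.1| <= side g'.1 + side g.1.
Proof.
move=> G0; have [x ex] : exists x, err g x * err g' x != 0.
  apply: contrapT => /forallNP h; case/eqP: G0.
  rewrite /gram (_ : (fun x => _) = cst 0) ?Rintegral_cst0//.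
    by rewrite /Rintegral integral0.
  by apply/funext => x; apply/eqP; rewrite -[_ == _]negbK; exact/negP/h.
move: ex; rewrite mulf_eq0 negb_or => /andP[eg eg'].
rewrite -(subrKA x); apply: (le_trans (ler_normD _ _)).
rewrite distrC lerD//; first exact: (err_supp h0E eta8 nA eg').
exact: (err_supp h0E eta8 nA eg).
Qed.

(* Otherwise [err g] is constant on the support of [err g'], which has mean
   zero. *)
Lemma gram_neq0_grid g g' : gram g g' != 0 -> exists e, near_grid g e g'.
Proof.
move=> G0; pose c := center g'.1.
have [x ex ecx] : exists2 x, err g' x != 0 & err g c != err g x.
  apply: contrapT => h; case/eqP: G0.
  rewrite /gram; transitivity (Rintegral leb setT (fun x => err g c * err g' x)).
    apply: eq_Rintegral => x _; have [->|e'x] := eqVneq (err g' x) 0; first by rewrite !mulr0.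
    have [->//|ecx] := eqVneq (err g c) (err g x).
    by exfalso; apply: h; exists x.
  have ierr := integrable_err h0E eta8 nA g'.
  rewrite RintegralZl//.
  by rewrite [X in _ * X](Rintegral_err h0E eta0 eta8 nA g') mulr0.
(* If the difference of two terms changes, one of the terms does; [b] records which. *)
have [b tb] : exists b, haar h0 g (tau g b c) != haar h0 g (tau g b x).
  case: (eqVneq (haar h0 g (tau g false c)) (haar h0 g (tau g false x))); last by exists false.
  case: (eqVneq (haar h0 g (tau g true c)) (haar h0 g (tau g true x))); last by exists true.
  by move=> h1 h2; move: ecx; rewrite !err_tau h1 h2 eqxx.
have [i [k ik]] := haar_neq_grid h0E tb; exists (b, i, k).
rewrite /near_grid /=; apply: (le_trans ik).
have [B [z [nB ->]]] := tau_nearP g b.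
have -> : perturb g.1 B z c i ord0 - perturb g.1 B z x i ord0 =
    (perturb g.1 B z c - perturb g.1 B z x) i ord0 by rewrite !mxE.
apply: (le_trans (ler_coord_norm _ _)); apply: (le_trans (norm_perturbB _ _ _ nB eta8)).
by rewrite ler_pM2l// distrC; exact: (err_supp h0E eta8 nA ex).
Qed.

(** There are [d.+1 * 6] possible hyperplanes, straight or tilted. For one of them, any two centers
    are within 4 l(Q), that is [4 * 2 ^ m] small sides. If they differ only along its axis, their
    images are within 4 small sides of each other, and [perturb_diag] turns this into 8. *)
Lemma count_below g (m : nat) (s : seq (haar_index d.+1)) :
  uniq s -> (forall g', g' \in s -> g'.1.1 = g.1.1 - m%:Z) ->
  (forall g', g' \in s -> gram g g' != 0) ->
  (size s <= d.+1 * 6 * ((5 * 2 ^ m) ^ d * 9 * 2 ^ d.+1))%N.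
Proof.
move=> us sm sG.
have sideE g' : g' \in s -> side g.1 = 2 ^+ m * side g'.1.
  move=> /sm e; rewrite /side e exprnP -expfzDr ?pnatr_eq0//.
  by congr (_ ^ _); lia.
have eqs g' g'' : g' \in s -> g'' \in s -> g'.1.1 = g''.1.1.
  by move=> /sm -> /sm ->.
apply: (@leq_trans (\sum_e count (near_grid g e) s)).
  apply: size_le_sum_count; apply/allP => g' /sG /gram_neq0_grid[e ne].
  by apply/existsP; exists e.
rewrite -[(d.+1 * 6)%N](_ : #|{: bool * 'I_d.+1 * 'I_3}| = _); last first.
  by rewrite !card_prod card_bool !card_ord; lia.
rewrite -sum_nat_const; apply: leq_sum => e _; rewrite -size_filter.
apply: (@leq_trans ((4 * 2 ^ m).+1 ^ d * 9 * 2 ^ d.+1)); last first.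
  rewrite !leq_mul2r; apply/orP; right; apply/orP; right.
  by case: (d) => // d'; rewrite leq_exp2r//; have := expn_gt0 2 m; lia.
apply: (@size_haar_index_le _ (g.1.1 - m%:Z) _ e.1.2).
- exact: filter_uniq.
- by move=> g'; rewrite mem_filter => /andP[_]; exact: sm.
- move=> g' g'' l; rewrite !mem_filter => /andP[_ s'] /andP[_ s''].
  apply: (@index_dist R); first exact: eqs.
  have h' := le_trans (ler_coord_norm _ l) (gram_neq0_center (sG _ s')).
  have h'' := le_trans (ler_coord_norm _ l) (gram_neq0_center (sG _ s'')).
  have e' := sideE _ s'; have e'' := sideE _ s''.
  have s0 := side_gt0 (R := R) g'.1; have s0' := side_gt0 (R := R) g''.1.
  have le' : side g'.1 <= side g.1 by rewrite e' ler_peMl ?exprn_ege1 ?ler1n// ltW.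
  have le'' : side g''.1 <= side g.1 by rewrite e'' ler_peMl ?exprn_ege1 ?ler1n// ltW.
  rewrite natrM natrX -mulrA -e'; move: h' h''; rewrite !mxE !ler_norml; lra.
- move=> g' g''; rewrite !mem_filter => /andP[n' s'] /andP[n'' s''] off.
  apply: (@index_dist R _ _ _ _ 8); first exact: eqs.
  have ecenter j : j != e.1.2 -> center g'.1 j ord0 = center g''.1 j ord0.
    move=> /off oj; apply/eqP; rewrite -subr_eq0 centerB ?oj ?subrr ?mul0r//.
    exact: eqs.
  have [B [z [nB tB]]] := tau_nearP g e.1.1.
  apply: (le_trans (perturb_diag g.1 nB eta8 ecenter)); rewrite -tB.
  rewrite (_ : 8%:R * _ = 2 * (4 * side g'.1)); last by ring.
  rewrite ler_pM2l//.
  move: n' n''; rewrite /near_grid (_ : side g''.1 = side g'.1).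
    by rewrite !ler_norml; lra.
  by rewrite /side (eqs _ _ s' s'').
Qed.

End gram.

Lemma ler_sum_size (R : numDomainType) (T : Type) (s : seq T) (P : pred T)
    (f : T -> R) (t : R) (N : nat) :
  0 <= t -> (forall x, P x -> f x <= t) ->
  (size [seq x <- s | P x && (f x != 0%R)] <= N)%N ->
  \sum_(x <- s | P x) f x <= N%:R * t.
Proof.
move=> t0 ft sN; rewrite (bigID (fun x => f x != 0))/= [X in _ + X]big1 ?addr0; last first.
  by move=> x /andP[_]; rewrite negbK => /eqP.
apply: (@le_trans _ _ (\sum_(x <- s | P x && (f x != 0)) t)).
  by apply: ler_sum => x /andP[Px _]; exact: ft.
rewrite -big_filter big_const_seq count_predT iter_addr_0 -[leLHS]mulr_natl ler_wpM2r//.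
by rewrite ler_nat.
Qed.

(** * Weights and row sums for Schur's test *)

Section haar_weights.
Context {R : realType} {d : nat}.
Local Notation amp := (@amp R d.+1).
Implicit Type Q : dyadic_cube d.+1.

(** Amplitudes and weights are integer powers of 2^(-1/2), so comparing them needs no real
    exponents. *)
Definition ratio : R := 2 `^ (- 2^-1).

Lemma ratio_gt0 : 0 < ratio. Proof. exact: powR_gt0. Qed.

Lemma ratio_sqr : ratio ^+ 2 = 2^-1.
Proof.
by rewrite -powR_mulrn ?powR_ge0// -powRrM mulNr mulVf// powR_inv1.
Qed.

Lemma ratio_le : ratio <= 3 / 4.
Proof. by have := ratio_sqr; have := ratio_gt0; nra. Qed.

Lemma geometric_ratio_le4 M : \sum_(m < M) ratio ^+ m <= 4.
Proof.
(* The remainder makes the induction close: [1 + 4 * ratio <= 4] because [ratio <= 3 / 4]. *)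
suff : \sum_(m < M) ratio ^+ m + 4 * ratio ^+ M <= 4.
  have : 0 <= ratio ^+ M by rewrite exprn_ge0// ltW// ratio_gt0.
  lra.
elim: M => [|M IHM]; first by rewrite big_ord0 expr0 add0r mulr1.
rewrite big_ord_recr /= exprS; apply: le_trans IHM.
have := ratio_le; have : 0 <= ratio ^+ M by rewrite exprn_ge0// ltW// ratio_gt0.
by move: (ratio ^+ M) ratio (\sum_(_ < _) _) => p q S; nra.
Qed.

Lemma amp_ratio Q : amp Q = ratio ^ (Q.1 * d.+1).
Proof.
rewrite /amp /ratio -powR_intmul ?powR_ge0// -powRrM; congr (_ `^ _).
by rewrite rmorphM /=; field.
Qed.

(* [l(Q)^(d/2)], where [d + 1] is the dimension *)
Definition weight Q : R := ratio ^ (- Q.1 * d).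

Lemma weight_gt0 Q : 0 < weight Q.
Proof. by rewrite exprz_gt0// ratio_gt0. Qed.

Let ratio_unit : ratio \is a GRing.unit. Proof. by rewrite unitfE gt_eqF// ratio_gt0. Qed.

Lemma amp_shift Q Q' (m : nat) : Q.1 = Q'.1 + m ->
  amp Q / amp Q' = ratio ^+ (m * d.+1).
Proof.
move=> e; rewrite !amp_ratio e mulrDl exprzDr// mulrAC divff ?mul1r//.
by rewrite expfz_neq0// gt_eqF// ratio_gt0.
Qed.

Lemma weight_shift Q Q' (m : nat) : Q.1 = Q'.1 + m ->
  weight Q' = ratio ^+ (m * d) * weight Q.
Proof.
move=> e; rewrite /weight [in X in _ = X * _]exprnP -exprzDr// e.
by congr (_ ^ _); rewrite -?PoszM; ring.
Qed.

End haar_weights.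

(** The entry constant times the bound of [count_below] at [m = 0]. *)
Definition row_cst (R : realType) (d : nat) : R :=
  gram_cst R d * (d.+1 * 6 * (5 ^ d * 9 * 2 ^ d.+1))%:R.

Section row_sums.
Context {R : realType} {d : nat}.
Local Notation leb := (@lebesgue_cV R d.+1).
Local Notation side := (@side R d.+1).
Local Notation center := (@cube_center R d.+1).
Local Notation weight := (@weight R d).
Local Notation ratio := (@ratio R).
Variable h0 : haar_label d.+1 -> 'cV[R]_d.+1 -> R.
Hypothesis h0E : haar_enumeration h0.
Variables (A : haar_index d.+1 -> 'M[R]_d.+1) (y : haar_index d.+1 -> 'cV[R]_d.+1).
Variable eta : R.
Hypotheses (eta0 : 0 <= eta) (eta8 : eta <= 8^-1).
Hypothesis nA : forall g, near_id (A g) (y g) eta.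
Implicit Type g : haar_index d.+1.

Local Notation gram := (gram h0 A y).

(** Centers of larger cubes that interact with [g] lie within two of their own sides of its center,
    so their indices differ by at most 4 in every direction, whatever [m] is. No hyperplane is
    involved, and the axis given to the counting lemma is arbitrary. *)
Lemma count_above g (m : nat) (s : seq (haar_index d.+1)) :
  uniq s -> (forall g', g' \in s -> g'.1.1 = g.1.1 + m) ->
  (forall g', g' \in s -> gram g g' != 0) ->
  (size s <= 5 ^ d * 9 * 2 ^ d.+1)%N.
Proof.
move=> us sm sG.
have sep g' g'' l : g' \in s -> g'' \in s -> `|g'.1.2 l - g''.1.2 l| < 5%:Z.
  move=> s' s''; have es : g'.1.1 = g''.1.1 by rewrite (sm _ s') (sm _ s'').
  apply: (@index_dist R _ _ _ _ 4) => //.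
  have h' := le_trans (ler_coord_norm _ l) (gram_neq0_center h0E eta8 nA (sG _ s')).
  have h'' := le_trans (ler_coord_norm _ l) (gram_neq0_center h0E eta8 nA (sG _ s'')).
  have eside : side g''.1 = side g'.1 by rewrite /side es.
  have les : side g.1 <= side g'.1.
    by rewrite /side (sm _ s') ler_weXz2l ?ler1n//; lia.
  by move: h' h''; rewrite eside !mxE !ler_norml; lra.
apply: (@size_haar_index_le _ (g.1.1 + m) 4 ord0) => // g' g'' s' s'' _.
by apply: lt_trans (sep _ _ _ s' s'') _.
Qed.

Let term g g' := `|gram g g'| * weight g'.1.

Let term_neq0 g g' : term g g' != 0 -> gram g g' != 0.
Proof. by rewrite /term mulf_eq0 negb_or normr_eq0 => /andP[]. Qed.

Let gc0 : 0 <= gram_cst R d * eta.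
Proof. by rewrite mulr_ge0// /gram_cst !mulr_ge0// exprn_ge0. Qed.

Lemma row_sum_below g (m : nat) (s : seq (haar_index d.+1)) : uniq s ->
  \sum_(g' <- s | g'.1.1 == g.1.1 - m%:Z) `|gram g g'| * weight g'.1 <=
  row_cst R d * eta * ratio ^+ m * weight g.1.
Proof.
move=> us; have r0 := @ratio_gt0 R; have w0 := weight_gt0 (R := R) g.1.
have rge0 := ltW r0; have wge0 := ltW w0.
pose t := gram_cst R d * eta * ratio ^+ (m * d.+1) * (ratio ^+ (m * d) * weight g.1).
have t0 : 0 <= t by rewrite !mulr_ge0// ?exprn_ge0.
pose N := (d.+1 * 6 * ((5 * 2 ^ m) ^ d * 9 * 2 ^ d.+1))%N.
apply: (@le_trans _ _ (N%:R * t)).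
  apply: ler_sum_size => // [g' /eqP e|].
    have e' : g.1.1 = g'.1.1 + m by rewrite e subrK.
    rewrite (weight_shift e') /t ler_wpM2r ?mulr_ge0 ?exprn_ge0//.
    rewrite -(amp_shift (R := R) e'). exact: (gram_le h0E eta0 eta8 nA).
  apply: (count_below h0E eta0 eta8 nA (g := g)).
  - exact: filter_uniq.
  - by move=> g'; rewrite mem_filter => /andP[/andP[/eqP ->]].
  - by move=> g'; rewrite mem_filter => /andP[/andP[_ /term_neq0]].
rewrite le_eqVlt; apply/orP; left; apply/eqP.
(* [2 ^ (m * d)], from the number of cubes, absorbs all of
   [ratio ^+ (m * d.+1 + m * d)] but the factor [ratio ^+ m]. *)
have cancel : ratio ^+ (m * d) * ratio ^+ (m * d) * (2 ^ (m * d))%:R = 1.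
  rewrite -expr2 exprAC ratio_sqr natrX -exprMn mulVf ?expr1n// pnatr_eq0//.
transitivity (row_cst R d * eta * ratio ^+ m * weight g.1 *
    (ratio ^+ (m * d) * ratio ^+ (m * d) * (2 ^ (m * d))%:R)).
  rewrite /row_cst /t /N (mulnS m d) exprD expnMn -expnM !natrM.
  ring.
by rewrite cancel mulr1.
Qed.

(** The count is bounded and the weights grow by 2^(md/2), against entries of size 2^(-m(d+1)/2). *)
Lemma row_sum_above g (m : nat) (s : seq (haar_index d.+1)) : uniq s ->
  \sum_(g' <- s | g'.1.1 == g.1.1 + m) `|gram g g'| * weight g'.1 <=
  row_cst R d * eta * ratio ^+ m * weight g.1.
Proof.
move=> us; have r0 := @ratio_gt0 R; have w0 := weight_gt0 (R := R) g.1.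
have rge0 := ltW r0; have wge0 := ltW w0.
pose t := gram_cst R d * eta * ratio ^+ m * weight g.1.
have t0 : 0 <= t by rewrite !mulr_ge0// ?exprn_ge0.
pose N := (5 ^ d * 9 * 2 ^ d.+1)%N.
apply: (@le_trans _ _ (N%:R * t)).
  apply: ler_sum_size => // [g' /eqP e|].
    have -> : t = gram_cst R d * eta * ratio ^+ (m * d.+1) * weight g'.1.
      by rewrite /t (weight_shift e) (mulnS m d) exprD; ring.
    rewrite ler_wpM2r ?(ltW (weight_gt0 _))// gramC -(amp_shift (R := R) e).
    exact: (gram_le h0E eta0 eta8 nA).
  apply: (count_above (g := g) (m := m)).
  - exact: filter_uniq.
  - by move=> g'; rewrite mem_filter => /andP[/andP[/eqP ->]].
  - by move=> g'; rewrite mem_filter => /andP[/andP[_ /term_neq0]].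
(* The factor [d.+1 * 6] is given away so that both directions share one constant. *)
rewrite (_ : _ * ratio ^+ m * weight g.1 = (d.+1 * 6)%:R * (N%:R * t)).
  by apply: ler_peMl; [exact: mulr_ge0|rewrite ler1n].
by rewrite /row_cst /t /N !natrM; ring.
Qed.

(** The 8 is 2 for the smaller and the larger cubes, times 4 for the geometric series. *)
Lemma row_sum_le g (s : seq (haar_index d.+1)) : uniq s ->
  \sum_(g' <- s) `|gram g g'| * weight g'.1 <= 8 * row_cst R d * eta * weight g.1.
Proof.
move=> us; have w0 := weight_gt0 (R := R) g.1.
have t0 g' : 0 <= term g g' by rewrite mulr_ge0// ltW// weight_gt0.
(* A finite list meets finitely many levels. Level difference 0 is counted on both sides, which is
   harmless since all terms are nonnegative. *)
pose M := (\max_(g' <- s) `|g.1.1 - g'.1.1|%N).+1.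
pose F g' (m : nat) := (if g'.1.1 == g.1.1 - m%:Z then term g g' else 0) +
  (if g'.1.1 == g.1.1 + m then term g g' else 0).
have F0 g' m : 0 <= F g' m by rewrite addr_ge0//; case: ifP.
apply: (@le_trans _ _ (\sum_(g' <- s) \sum_(m < M) F g' m)).
  rewrite !big_seq; apply: ler_sum => g' gs.
  have lt : (`|g.1.1 - g'.1.1| < M)%N by rewrite ltnS; exact: leq_bigmax_seq.
  rewrite (bigD1 (Ordinal lt))//= -[leLHS]addr0 lerD ?sumr_ge0// /F.
  have [ge|/ltW ge] := leP g'.1.1 g.1.1.
    have -> : g'.1.1 == g.1.1 - `|g.1.1 - g'.1.1|%N%:Z by apply/eqP; lia.
    by rewrite lerDl; case: ifP.
  have -> : g'.1.1 == g.1.1 + `|g.1.1 - g'.1.1|%N%:Z by apply/eqP; lia.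
  by rewrite lerDr; case: ifP.
rewrite exchange_big /=.
apply: (@le_trans _ _ (\sum_(m < M) 2 * row_cst R d * eta * weight g.1 * ratio ^+ m)).
  apply: ler_sum => m _; rewrite big_split /= -!big_mkcond.
  by have := row_sum_below g m us; have := row_sum_above g m us; lra.
rewrite -mulr_sumr.
have := geometric_ratio_le4 (R := R) M.
have : 0 <= row_cst R d * eta * weight g.1.
  by rewrite mulr_ge0 ?(ltW w0)// /row_cst mulrAC mulr_ge0.
move: (\sum_(_ < _) _) => S; nra.
Qed.

Lemma gram_form_le (s : seq (haar_index d.+1)) (a : haar_index d.+1 -> R) : uniq s ->
  \sum_(i <- s) \sum_(j <- s) a i * a j * gram i j <=
  8 * row_cst R d * eta * \sum_(i <- s) a i ^+ 2.
Proof.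
move=> us; apply: (@schur_test _ _ _ _ (weight \o fst)).
- by move=> i j; exact: gramC.
- by move=> i; exact: weight_gt0.
- by move=> i _; exact: row_sum_le.
Qed.

End row_sums.

Theorem corollary2 (R : realType) (d : nat) (d_ge1 : (1 <= d)%N) :
  exists c C : R, [/\ 0 < c, 0 < C &
    forall (h0 : haar_label d -> 'cV[R]_d -> R) (eta : R)
           (A : haar_index d -> 'M[R]_d) (y : haar_index d -> 'cV[R]_d),
      haar_enumeration h0 ->
      0 <= eta <= c ->
      (forall g : haar_index d, mxnorm_oo (A g - 1%:M) + `|y g| <= eta) ->
      let psi (g : haar_index d) (x : 'cV[R]_d) : R[i] :=
        (haar h0 g x - perturbed_haar h0 A y g x)%:C%C in
      AO psi /\ AOnorm psi <= C * Num.sqrt eta].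
Proof.
(* 1/8 is the threshold of all the affine estimates; [C] is the square root of the Bessel bound with
   [eta] factored out. *)
case: d d_ge1 => // d _; exists 8^-1, (Num.sqrt (8 * row_cst R d)).
have K0 : 0 < 8 * row_cst R d :> R.
  by rewrite mulr_gt0// /row_cst /gram_cst !mulr_gt0// ?exprn_gt0// ltr0n !muln_gt0 !expn_gt0.
split; [by rewrite invr_gt0|by rewrite sqrtr_gt0|].
move=> h0 eta A y h0E /andP[eta0 eta8] nA psi.
have B0 : 0 <= 8 * row_cst R d * eta by rewrite mulr_ge0// ltW.
rewrite -sqrtrM ?(ltW K0)//.
exact: (AO_of_gram (sqint_err h0E eta8 nA) B0 (gram_form_le h0E eta0 eta8 nA)).
Qed.
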